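(* Let $\xi$ be a tidy formula of the modal $\mu$-calculus. Then the parity formula $\mathbb{G}_\xi=(\mathrm{Clos}(\xi),\rightarrow_C\restriction_{\mathrm{Clos}(\xi)},L_n\restriction_{\mathrm{Clos}(\xi)},\Omega_g\restriction_{\mathrm{Clos}(\xi)},\xi)$, which is based on the closure graph of $\xi$, is equivalent to $\xi$, has exactly $|\mathrm{Clos}(\xi)|$ vertices, and satisfies $\mathit{ind}(\mathbb{G}_\xi)\le \mathit{ad}(\xi)$.
   Context: Syntax. Formulas of the modal $\mu$-calculus are taken in negation normal form: $\phi ::= \top \mid \bot \mid p \mid \neg p \mid x \mid \phi\land\phi\mid\phi\lor\phi\mid\Diamond\phi\mid\Box\phi\mid\mu x.\phi\mid\nu x.\phi$, where $p$ ranges over proposition letters and $x$ over an infinite supply of variables (which occur only positively). The formulas $\top,\bot,p,\neg p,x$ are atomic. $\mathrm{FV}(\phi)$ and $\mathrm{BV}(\phi)$ are the sets of free and bound variables of $\phi$; $\phi$ is tidy if $\mathrm{FV}(\phi)\cap\mathrm{BV}(\phi)=\varnothing$. A fixpoint formula is one of the form $\eta x.\chi$ with $\eta\in\{\mu,\nu\}$; it has type $\eta$, where $\mu$ counts as odd and $\nu$ as even parity, and $\bar\eta$ denotes the other operator. $\chi[\xi/x]$ is the result of replacing every free occurrence of $x$ in $\chi$ by $\xi$; $\xi$ is free for $x$ in $\chi$ if no free variable of $\xi$ becomes bound in $\chi[\xi/x]$. $|\phi|$ is the length of $\phi$ (number of nodes of its syntax tree). Traces and closure. The trace relation $\rightarrow_C$: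 $\phi_0\odot\phi_1\rightarrow_C\phi_i$ for $\odot\in\{\land,\lor\}$, $i\in\{0,1\}$; $\heartsuit\phi\rightarrow_C\phi$ for $\heartsuit\in\{\Diamond,\Box\}$; $\eta x.\phi\rightarrow_C\phi[\eta x.\phi/x]$; atomic formulas have no successors. $\twoheadrightarrow_C$ is the reflexive transitive closure of $\rightarrow_C$, $\mathrm{Clos}(\phi)=\{\psi\mid\phi\twoheadrightarrow_C\psi\}$ (a finite set), and a trace is a finite or infinite sequence of formulas with consecutive members related by $\rightarrow_C$. Write $\phi\equiv_C\psi$ iff $\phi\twoheadrightarrow_C\psi$ and $\psi\twoheadrightarrow_C\phi$; its equivalence classes are (closure) clusters, and $C(\phi)$ is the cluster of $\phi$. Free subformulas. $\phi\trianglelefteq_f\psi$ iff $\psi=\chi[\phi/y]$ for some formula $\chi$ and variable $y$ with $y\in\mathrm{FV}(\chi)$ and $\phi$ free for $y$ in $\chi$; $\phi\triangleleft_f\psi$ iff moreover $\phi\neq\psi$. Closure order. For a formula $\psi$, write $\rho\twoheadrightarrow_C^{\psi}\sigma$ iff there is a trace $\rho=\chi_0\rightarrow_C\cdots\rightarrow_C\chi_n=\sigma$ ($n\ge0$) with $\psi\trianglelefteq_f\chi_i$ for all $i\le n$. For fixpoint formulas $\phi,\psi$: $\phi\sqsubseteq_C\psi$ iff $\psi\twoheadrightarrow_C^{\psi}\phi$; $\phi\sqsubset_C\psi$ iff $\phi\sqsubseteq_C\psi$ and $\psi\not\sqsubseteq_C\phi$. Chains. An alternating $\sqsubset_C$-chain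 of length $n$ is a sequence $\eta_1x_1.\chi_1,\dots,\eta_nx_n.\chi_n$ of tidy fixpoint formulas with $\eta_ix_i.\chi_i\sqsubset_C\eta_{i+1}x_{i+1}.\chi_{i+1}$ and $\eta_{i+1}=\bar\eta_i$ for all $i<n$; it starts at the first and leads up to the last formula. For a tidy fixpoint formula $\xi$, $h^\uparrow(\xi)$ (resp. $h^\downarrow(\xi)$) is the maximal length of an alternating $\sqsubset_C$-chain starting at (resp. leading up to) $\xi$. For a cluster $C$, $\mathit{cd}(C)$ is the maximal length of an alternating $\sqsubset_C$-chain inside $C$. Global priority map and $\mathbb{G}_\xi$. For a tidy fixpoint formula $\psi=\eta y.\phi$ let $d=\mathit{cd}(C(\psi))-h^\uparrow(\psi)$ and set $\Omega_g(\psi)=d$ if $d$ has parity $\eta$ and $\Omega_g(\psi)=d+1$ otherwise; $\Omega_g$ is undefined on non-fixpoint formulas. The natural labelling is $L_n(\phi)=\phi$ for atomic $\phi$, $L_n(\heartsuit\psi)=\heartsuit$, $L_n(\psi_0\odot\psi_1)=\odot$, $L_n(\eta x.\psi)=\epsilon$. Parity formulas. A parity formula is a tuple $(V,E,L,\Omega,v_I)$ with $V$ finite, $E\subseteq V\times V$, $L$ labelling each vertex by an atomic formula (such vertices have no successors), by $\Diamond,\Box$ or $\epsilon$ (exactly one successor) or by $\land,\lor$, $\Omega$ a partial map $V\to\omega$, $v_I\in V$, such that every cycle contains a vertex in $\mathrm{Dom}(\Omega)$. Its semantics on a Kripke model $\mathbb{S}=(S,R,V)$ (valuation on letters and free variables)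 is given by the evaluation game with positions $(v,s)$: at an atomic-labelled $v$ the match ends and $\exists$ wins iff $s$ satisfies the atom; at $\lor$ (resp. $\land$) $\exists$ (resp. $\forall$) picks an $E$-successor $u$ and moves to $(u,s)$; at $\Diamond$ (resp. $\Box$) $\exists$ (resp. $\forall$) picks $t$ with $sRt$ and moves to $(u,t)$, $u$ the successor; at $\epsilon$ the move is to $(u,s)$; a player who cannot move loses; an infinite match is won by $\exists$ iff the largest priority occurring infinitely often is even. $\mathbb{S},s\Vdash\mathbb{G}$ iff $\exists$ wins from $(v_I,s)$; $\mathbb{G}$ is equivalent to a formula $\xi$ iff $\mathbb{S},s\Vdash\mathbb{G}\Leftrightarrow\mathbb{S},s\Vdash\xi$ for all pointed models. A cluster of a parity formula is a class of mutually $E$-reachable vertices; its index is the maximal $n$ for which there are $v_1,\dots,v_n$ in the cluster with $\Omega(v_1)<\cdots<\Omega(v_n)$ and consecutive priorities of different parity; $\mathit{ind}(\mathbb{G})$ is the maximal index of its clusters. Alternation hierarchy. The classes $\mathrm{AH}_\eta(n)$ ($\eta\in\{\mu,\nu\}$, $n\in\omega$) are the least classes such that: (1) all atomic formulas belong to $\mathrm{AH}_\eta(0)$; (2) each $\mathrm{AH}_\eta(n)$ is closed under $\land,\lor,\Diamond,\Box$; (3) if $\chi\in\mathrm{AH}_\eta(n)$ then $\bar\eta x.\chi\in\mathrm{AH}_\eta(n)$; (4) if $\chi,\xi\in\mathrm{AH}_\eta(n)$ and $\xi$ is free for $x$ in $\chi$ then $\chi[\xi/x]\in\mathrm{AH}_\eta(n)$;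 (5) $\mathrm{AH}_\mu(n)\cup\mathrm{AH}_\nu(n)\subseteq\mathrm{AH}_\eta(n+1)$. $\mathit{ad}(\xi)$ is the least $n$ with $\xi\in\mathrm{AH}_\mu(n)\cap\mathrm{AH}_\nu(n)$. *)

(* Defs.v *)
From Stdlib Require Import List Arith Bool Relations ClassicalEpsilon.
Import ListNotations.

Definition maxP (P : nat -> Prop) (n : nat) : Prop :=
  P n /\ forall m, P m -> m <= n.
Definition minP (P : nat -> Prop) (n : nat) : Prop :=
  P n /\ forall m, P m -> n <= m.

Definition max_opt (P : nat -> Prop) : option nat :=
  match excluded_middle_informative (exists n, maxP P n) with
  | left H => Some (proj1_sig (constructive_indefinite_description _ H))
  | right _ => None
  end.

Definition min_opt (P : nat -> Prop) : option nat :=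
  match excluded_middle_informative (exists n, minP P n) with
  | left H => Some (proj1_sig (constructive_indefinite_description _ H))
  | right _ => None
  end.

Inductive fop : Type := FMu | FNu.

Definition dual (e : fop) : fop := match e with FMu => FNu | FNu => FMu end.

Inductive formula : Type :=
| FTop | FBot
| FProp (p : nat) | FNProp (p : nat)
| FVar (x : nat)
| FAnd (a b : formula) | FOr (a b : formula)
| FDia (a : formula) | FBox (a : formula)
| FFix (e : fop) (x : nat) (a : formula).

Definition atomic (f : formula) : Prop :=
  match f with FTop | FBot | FProp _ | FNProp _ | FVar _ => True | _ => False end.

Definition is_fix (f : formula) : Prop :=
  match f with FFix _ _ _ => True | _ => False end.

Fixpoint fv (f : formula) : list nat :=
  match f with
  | FVar x => [x]
  | FAnd a b | FOr a b => fv a ++ fv b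
  | FDia a | FBox a => fv a
  | FFix _ x a => filter (fun y => negb (Nat.eqb y x)) (fv a)
  | _ => []
  end.

Fixpoint bv (f : formula) : list nat :=
  match f with
  | FAnd a b | FOr a b => bv a ++ bv b
  | FDia a | FBox a => bv a
  | FFix _ x a => x :: bv a
  | _ => []
  end.

Definition tidy (f : formula) : Prop :=
  forall x, In x (fv f) -> ~ In x (bv f).

Fixpoint subst (c : formula) (x : nat) (s : formula) : formula :=
  match c with
  | FVar y => if Nat.eqb y x then s else FVar y
  | FAnd a b => FAnd (subst a x s) (subst b x s)
  | FOr a b => FOr (subst a x s) (subst b x s)
  | FDia a => FDia (subst a x s)
  | FBox a => FBox (subst a x s)
  | FFix e y a => if Nat.eqb y x then FFix e y a else FFix e y (subst a x s)
  | f => f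
  end.

Fixpoint free_for (s : formula) (x : nat) (c : formula) : Prop :=
  match c with
  | FAnd a b | FOr a b => free_for s x a /\ free_for s x b
  | FDia a | FBox a => free_for s x a
  | FFix _ y a =>
      if Nat.eqb y x then True
      else (In x (fv a) -> ~ In y (fv s)) /\ free_for s x a
  | _ => True
  end.

Inductive step : formula -> formula -> Prop :=
| st_andl a b : step (FAnd a b) a
| st_andr a b : step (FAnd a b) b
| st_orl a b : step (FOr a b) a
| st_orr a b : step (FOr a b) b
| st_dia a : step (FDia a) a
| st_box a : step (FBox a) a
| st_fix e x a : step (FFix e x a) (subst a x (FFix e x a)).

Definition Clos (xi psi : formula) : Prop := clos_refl_trans formula step xi psi.

Definition equivC (f g : formula) : Prop := Clos f g /\ Clos g f.

Definition fsub (f g : formula) : Prop :=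
  exists c y, g = subst c y f /\ In y (fv c) /\ free_for f y c.

Definition crt (psi rho sigma : formula) : Prop :=
  fsub psi rho /\
  clos_refl_trans formula (fun a b => step a b /\ fsub psi b) rho sigma.

Definition csub (f g : formula) : Prop := is_fix f /\ is_fix g /\ crt g g f.
Definition csub_strict (f g : formula) : Prop := csub f g /\ ~ csub g f.

Definition fix_type (f : formula) : option fop :=
  match f with FFix e _ _ => Some e | _ => None end.

Fixpoint alt_chain (l : list formula) : Prop :=
  match l with
  | [] => True
  | f :: r =>
      tidy f /\ is_fix f /\
      match r with
      | [] => True
      | g :: _ => csub_strict f g /\
                  (exists e, fix_type f = Some e /\ fix_type g = Some (dual e)) /\
                  alt_chain r
      end
  end.

Definition h_up (f : formula) : option nat :=
  max_opt (fun n => exists l, alt_chain (f :: l) /\ length (f :: l) = n).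

Definition cd_cluster (f : formula) : option nat :=
  max_opt (fun n => exists l, alt_chain l /\ length l = n /\
                               forall g, In g l -> equivC g f).

Definition is_odd_type (e : fop) : bool := match e with FMu => true | FNu => false end.

Definition Omega_g (f : formula) : option nat :=
  match f with
  | FFix e _ _ =>
      if excluded_middle_informative (tidy f) then
        match cd_cluster f, h_up f with
        | Some c, Some h =>
            let d := c - h in
            Some (if Bool.eqb (Nat.odd d) (is_odd_type e) then d else S d)
        | _, _ => None
        end
      else None
  | _ => None
  end.

Inductive label : Type :=
| LAtom (a : formula) | LDia | LBox | LAnd | LOr | LEps.

Definition L_n (f : formula) : label :=
  match f with
  | FAnd _ _ => LAnd | FOr _ _ => LOr
  | FDia _ => LDia | FBox _ => LBox
  | FFix _ _ _ => LEps
  | a => LAtom a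
  end.

Record pformula : Type := PF {
  pV : Type;
  pE : pV -> pV -> Prop;
  pL : pV -> label;
  pOm : pV -> option nat;
  pvI : pV
}.

Fixpoint epath {V : Type} (E : V -> V -> Prop) (v : V) (p : list V) : Prop :=
  match p with
  | [] => True
  | u :: p' => E v u /\ epath E u p'
  end.

Definition is_parity_formula (G : pformula) : Prop :=
  (exists l : list (pV G), forall v, In v l) /\
  (forall v, match pL G v with
             | LAtom a => atomic a /\ forall u, ~ pE G v u
             | LDia | LBox | LEps =>
                 exists u, pE G v u /\ forall w, pE G v w -> w = u
             | LAnd | LOr => True
             end) /\
  (forall v p, p <> [] -> epath (pE G) v p -> last p v = v ->
     exists u, In u p /\ pOm G u <> None).

(* Kripke models; the valuation covers letters and (free) variables. *)
Record kripke : Type := KM {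
  St : Type;
  Rel : St -> St -> Prop;
  ValP : nat -> St -> Prop;
  ValX : nat -> St -> Prop
}.

Definition sat_atom (M : kripke) (a : formula) (s : St M) : Prop :=
  match a with
  | FTop => True | FBot => False
  | FProp p => ValP M p s | FNProp p => ~ ValP M p s
  | FVar x => ValX M x s
  | _ => False
  end.

Inductive player : Type := Eloise | Abelard.

Definition owner (l : label) : player :=
  match l with LAnd | LBox => Abelard | _ => Eloise end.

Section Game.
Variables (M : kripke) (G : pformula).

Definition pos : Type := (pV G * St M)%type.

Definition gmove (p q : pos) : Prop :=
  match pL G (fst p) with
  | LAtom _ => False
  | LDia | LBox => pE G (fst p) (fst q) /\ Rel M (snd p) (snd q)
  | _ => pE G (fst p) (fst q) /\ snd q = snd p
  end.

Definition gowner (p : pos) : player := owner (pL G (fst p)).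

Definition stuck_win (p : pos) : Prop :=
  match pL G (fst p) with
  | LAtom a => sat_atom M a (snd p)
  | l => owner l = Abelard
  end.

(* strategies for Eloise: histories are lists with the current position first *)
Definition strategy : Type := list pos -> pos.

Inductive cons_hist (sg : strategy) (p0 : pos) : list pos -> Prop :=
| ch_start : cons_hist sg p0 [p0]
| ch_step h p q : cons_hist sg p0 (p :: h) -> gmove p q ->
    (gowner p = Eloise -> q = sg (p :: h)) -> cons_hist sg p0 (q :: p :: h).

Fixpoint hist (pi : nat -> pos) (n : nat) : list pos :=
  match n with 0 => [pi 0] | S k => pi (S k) :: hist pi k end.

Definition parity_win (pi : nat -> pos) : Prop :=
  exists k, Nat.even k = true /\
    (forall N, exists n, N <= n /\ pOm G (fst (pi n)) = Some k) /\
    (exists N, forall n m, N <= n -> pOm G (fst (pi n)) = Some m -> m <= k).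

Definition winning (sg : strategy) (p0 : pos) : Prop :=
  (forall h p, cons_hist sg p0 (p :: h) -> gowner p = Eloise ->
     (exists q, gmove p q) -> gmove p (sg (p :: h))) /\
  (forall h p, cons_hist sg p0 (p :: h) -> (forall q, ~ gmove p q) -> stuck_win p) /\
  (forall pi : nat -> pos, pi 0 = p0 ->
     (forall n, gmove (pi n) (pi (S n)) /\
                (gowner (pi n) = Eloise -> pi (S n) = sg (hist pi n))) ->
     parity_win pi).

Definition pf_sat (s : St M) : Prop := exists sg, winning sg (pvI G, s).

Definition same_cluster (u v : pV G) : Prop :=
  clos_refl_trans _ (pE G) u v /\ clos_refl_trans _ (pE G) v u.

Fixpoint alt_prio (vs : list (pV G)) : Prop :=
  match vs with
  | [] => True
  | v :: r =>
      pOm G v <> None /\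
      match r with
      | [] => True
      | w :: _ => (exists a b, pOm G v = Some a /\ pOm G w = Some b /\ a < b /\
                               Nat.even a <> Nat.even b) /\ alt_prio r
      end
  end.

Definition ind : option nat :=
  max_opt (fun n => exists v vs, length vs = n /\ alt_prio vs /\
                                  forall u, In u vs -> same_cluster v u).
End Game.

Definition upd {S : Type} (rho : nat -> S -> Prop) (x : nat) (U : S -> Prop) :
  nat -> S -> Prop := fun y => if Nat.eqb y x then U else rho y.

Fixpoint sem (M : kripke) (rho : nat -> St M -> Prop) (f : formula) : St M -> Prop :=
  match f with
  | FTop => fun _ => True
  | FBot => fun _ => False
  | FProp p => ValP M p
  | FNProp p => fun s => ~ ValP M p s
  | FVar x => rho x
  | FAnd a b => fun s => sem M rho a s /\ sem M rho b s
  | FOr a b => fun s => sem M rho a s \/ sem M rho b s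
  | FDia a => fun s => exists t, Rel M s t /\ sem M rho a t
  | FBox a => fun s => forall t, Rel M s t -> sem M rho a t
  | FFix FMu x a => fun s =>
      forall U : St M -> Prop, (forall t, sem M (upd rho x U) a t -> U t) -> U s
  | FFix FNu x a => fun s =>
      exists U : St M -> Prop, (forall t, U t -> sem M (upd rho x U) a t) /\ U s
  end.

Definition fsat (M : kripke) (s : St M) (f : formula) : Prop := sem M (ValX M) f s.

Definition clos_vertex (xi : formula) : Type := { psi : formula | Clos xi psi }.

Definition G_of (xi : formula) : pformula :=
  PF (clos_vertex xi)
     (fun a b => step (proj1_sig a) (proj1_sig b))
     (fun a => L_n (proj1_sig a))
     (fun a => Omega_g (proj1_sig a))
     (exist _ xi (rt_refl formula step xi)).

Inductive AH : fop -> nat -> formula -> Prop :=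
| AH_atom e a : atomic a -> AH e 0 a
| AH_and e n a b : AH e n a -> AH e n b -> AH e n (FAnd a b)
| AH_or e n a b : AH e n a -> AH e n b -> AH e n (FOr a b)
| AH_dia e n a : AH e n a -> AH e n (FDia a)
| AH_box e n a : AH e n a -> AH e n (FBox a)
| AH_fix e n x c : AH e n c -> AH e n (FFix (dual e) x c)
| AH_subst e n c x s : AH e n c -> AH e n s -> free_for s x c -> AH e n (subst c x s)
| AH_up e n f : (AH FMu n f \/ AH FNu n f) -> AH e (S n) f.

Definition ad (xi : formula) : option nat :=
  min_opt (fun n => AH FMu n xi /\ AH FNu n xi).

(* Main.v *)
Require Import Defs.
From Stdlib Require Import List Arith Bool Lia Relations.
From Stdlib Require Import Classical ClassicalEpsilon ProofIrrelevance.
Import ListNotations.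

(** Along a trace from a tidy fixpoint formula [psi], either every formula has
    [psi] as a free subformula, or some formula is strictly shorter than [psi].
    Hence [phi] lies below [psi] in the closure order iff some trace leads from
    [psi] to [phi] through formulas at least as long as [psi].  A shortest
    formula of a cluster is therefore its maximum, and a shortest formula
    occurring infinitely often on an infinite trace dominates that trace.  All
    formulas of height [h_up = 1] in a cluster [C] have the type of its maximum,
    so the type of a formula of [C] is determined by the parity of its height,
    and the priorities in [C] lie in an interval of [cd(C)] numbers.  Induction
    on membership in the alternation hierarchy bounds the alternating chains.

    For adequacy, one player keeps an annotated formula, true for Eloise and
    false for Abelard, in which unfolded fixpoints of the type losing for that
    player carry an ordinal approximant.  Along a trace dominated by such a
    fixpoint the annotations would decrease forever. *)

(** * Substitution *)

(** Unfolding copies only formulas that still contain [psi = eta x.chi], so a trace loses [psi] only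
    by descending into a subformula of [chi], which has fewer nodes than [psi]. Numbers thus replace
    the existential condition [fsub]. The obstacle is that [subst] never renames: it commutes with
    unfolding only if bound variables avoid the hole and the free variables of the substituted
    formula. For a tidy fixpoint this is achieved by opening the body with a fresh variable; the
    opened body is also shorter than the fixpoint, while the unfolding need not be, and so supplies
    the induction measure. The interval of priorities rests on the following: a formula of height 1
    whose type differed from that of the cluster's maximum would form a chain of length 2 with it.
    For adequacy the ordinals are part of the syntax. An unfolded fixpoint is copied together with
    its ordinal, so the first return to a dominating fixpoint finds exactly that copy, whatever
    happened to other annotations in between; no tuple of ordinals has to be compared. *)

Fixpoint len (f : formula) : nat :=
  match f with
  | FAnd a b | FOr a b => S (len a + len b)
  | FDia a | FBox a | FFix _ _ a => S (len a)
  | _ => 1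
  end.

Inductive subf (b : formula) : formula -> Prop :=
| subf_refl : subf b b
| subf_andl f g : subf b f -> subf b (FAnd f g)
| subf_andr f g : subf b g -> subf b (FAnd f g)
| subf_orl f g : subf b f -> subf b (FOr f g)
| subf_orr f g : subf b g -> subf b (FOr f g)
| subf_dia f : subf b f -> subf b (FDia f)
| subf_box f : subf b f -> subf b (FBox f)
| subf_fix e x f : subf b f -> subf b (FFix e x f).

Lemma len_pos f : 1 <= len f.
Proof. destruct f; simpl; lia. Qed.

Lemma subf_len b f : subf b f -> len b <= len f.
Proof. induction 1; simpl; lia. Qed.

Lemma subf_bv b f : subf b f -> incl (bv b) (bv f).
Proof.
  induction 1; simpl; intros v Hv; auto; try (apply in_or_app; auto); right; auto.
Qed.

Lemma fresh_var (l : list nat) : exists y, ~ In y l.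
Proof.
  exists (S (list_max l)); intros H.
  assert (Hm : list_max l <= list_max l) by lia.
  apply list_max_le in Hm; rewrite Forall_forall in Hm; apply Hm in H; lia.
Qed.

Lemma in_fv_fix v e x a : In v (fv (FFix e x a)) <-> In v (fv a) /\ v <> x.
Proof.
  simpl; rewrite filter_In, negb_true_iff, Nat.eqb_neq; tauto.
Qed.

Lemma subst_notin c x s : ~ In x (fv c) -> subst c x s = c.
Proof.
  induction c; intros H; simpl in *; auto;
    try (rewrite in_app_iff in H; rewrite IHc1, IHc2 by tauto; reflexivity);
    try (rewrite IHc by tauto; reflexivity).
  - destruct (Nat.eqb_spec x0 x); tauto.
  - destruct (Nat.eqb_spec x0 x) as [|Hn]; auto.
    rewrite IHc; auto. intros Hc; apply H, filter_In.
    rewrite negb_true_iff, Nat.eqb_neq; auto.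
Qed.

Lemma fv_subst c x s v :
  In v (fv (subst c x s)) -> In v (fv s) \/ (In v (fv c) /\ v <> x).
Proof.
  induction c; intros H;
    try (simpl in *; rewrite ?in_app_iff in *; tauto).
  - simpl in H; destruct (Nat.eqb_spec x0 x); auto.
    simpl in *; right; split; auto; intros ->; intuition congruence.
  - simpl subst in H; destruct (Nat.eqb_spec x0 x) as [->|Hn];
      rewrite in_fv_fix in *; tauto.
Qed.

Lemma fv_subst_keep c x s v : In v (fv c) -> v <> x -> In v (fv (subst c x s)).
Proof.
  induction c; intros H Hv;
    try (simpl in *; rewrite ?in_app_iff in *; tauto).
  - simpl in *; destruct H as [->|[]].
    destruct (Nat.eqb_spec v x); simpl; tauto.
  - simpl subst; destruct (Nat.eqb_spec x0 x) as [->|Hn]; auto;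
      rewrite in_fv_fix in *; tauto.
Qed.

Lemma fv_subst_new c x s v :
  In x (fv c) -> In v (fv s) -> ~ In v (bv c) -> In v (fv (subst c x s)).
Proof.
  induction c; intros H Hv Hb;
    try (simpl in *; rewrite ?in_app_iff in *; tauto).
  - simpl in *; destruct H as [->|[]]; rewrite Nat.eqb_refl; auto.
  - simpl subst; rewrite in_fv_fix in H; simpl in Hb.
    destruct (Nat.eqb_spec x0 x) as [->|Hn]; [tauto|].
    rewrite in_fv_fix; split; [tauto|]; intros ->; tauto.
Qed.

Lemma bv_subst c x s v : In v (bv (subst c x s)) -> In v (bv c) \/ In v (bv s).
Proof.
  induction c; simpl; rewrite ?in_app_iff; try tauto.
  - destruct (Nat.eqb_spec x0 x); simpl; auto.
  - destruct (Nat.eqb_spec x0 x); simpl; tauto.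
Qed.

Lemma bv_subst_keep c x s v : In v (bv c) -> In v (bv (subst c x s)).
Proof.
  induction c; simpl; rewrite ?in_app_iff; try tauto.
  destruct (Nat.eqb_spec x0 x); simpl; tauto.
Qed.

Lemma bv_subst_new c x s v : In x (fv c) -> In v (bv s) -> In v (bv (subst c x s)).
Proof.
  induction c; intros H Hv;
    try (simpl in *; rewrite ?in_app_iff in *; tauto).
  - simpl in *; destruct H as [->|[]]; rewrite Nat.eqb_refl; auto.
  - simpl subst; rewrite in_fv_fix in H.
    destruct (Nat.eqb_spec x0 x) as [->|Hn]; simpl; tauto.
Qed.

Lemma len_subst_var c x y : len (subst c x (FVar y)) = len c.
Proof.
  induction c; simpl; auto.
  - destruct (Nat.eqb_spec x0 x); auto.
  - destruct (Nat.eqb_spec x0 x); simpl; auto.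
Qed.

Lemma bv_subst_var c x y : bv (subst c x (FVar y)) = bv c.
Proof.
  induction c; simpl; auto; try congruence.
  - destruct (Nat.eqb_spec x0 x); auto.
  - destruct (Nat.eqb_spec x0 x); simpl; congruence.
Qed.

Lemma len_subst_ge c x s : In x (fv c) -> len s <= len (subst c x s).
Proof.
  induction c; intros H;
    try (simpl in *; rewrite ?in_app_iff in *; solve [lia | intuition lia]).
  - simpl in *; destruct H as [->|[]]; rewrite Nat.eqb_refl; auto.
  - simpl subst; rewrite in_fv_fix in H.
    destruct (Nat.eqb_spec x0 x) as [->|Hn]; simpl; intuition lia.
Qed.

Lemma len_subst_eq c x s :
  In x (fv c) -> len (subst c x s) = len s -> c = FVar x.
Proof.
  destruct c; intros H Hl;
    try (simpl in *; rewrite ?in_app_iff in *; contradiction).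
  - simpl in H; destruct H as [->|[]]; auto.
  - simpl in *; rewrite in_app_iff in H.
    destruct H as [H|H]; apply (len_subst_ge _ _ s) in H; lia.
  - simpl in *; rewrite in_app_iff in H.
    destruct H as [H|H]; apply (len_subst_ge _ _ s) in H; lia.
  - simpl in *; apply (len_subst_ge _ _ s) in H; lia.
  - simpl in *; apply (len_subst_ge _ _ s) in H; lia.
  - simpl subst in Hl; rewrite in_fv_fix in H; destruct H as [H Hn].
    apply (len_subst_ge _ _ s) in H.
    destruct (Nat.eqb_spec x0 x); [congruence|]; simpl in Hl; lia.
Qed.

(** A binder of [x] in [c] would shield the copy of [b] inside [c] but not [b] on its own; hence the
    side condition. *)
Lemma len_subst_subf b c x s :
  subf b c -> ~ In x (bv c) -> len (subst b x s) <= len (subst c x s).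
Proof.
  induction 1; intros Hb; simpl in *; auto; rewrite ?in_app_iff in Hb;
    try (destruct (Nat.eqb_spec x0 x); [tauto|]; simpl);
    try (assert (len (subst b x s) <= len (subst f x s)) by tauto; lia);
    try (assert (len (subst b x s) <= len (subst g x s)) by tauto; lia).
Qed.

(** Capture happens alike on both sides, so this textual identity only has to exclude shadowing of
    [y] and a replacement of [z] inside the copies of [s]. *)
Lemma subst_comm d z r y s :
  y <> z -> ~ In z (fv s) -> ~ In y (bv d) ->
  subst (subst d z r) y s = subst (subst d y s) z (subst r y s).
Proof.
  intros Hyz Hz; induction d; intros Hy; simpl in *; auto;
    rewrite ?in_app_iff in Hy;
    try (rewrite IHd1, IHd2 by tauto; reflexivity);
    try (rewrite IHd by tauto; reflexivity).
  - destruct (Nat.eqb_spec x z) as [->|Hxz].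
    + destruct (Nat.eqb_spec z y); [congruence|]; simpl; rewrite Nat.eqb_refl; auto.
    + simpl; destruct (Nat.eqb_spec x y).
      * rewrite subst_notin; auto.
      * simpl; destruct (Nat.eqb_spec x z); congruence.
  - destruct (Nat.eqb_spec x y); [tauto|].
    destruct (Nat.eqb_spec x z) as [Exz|Hxz]; simpl;
      destruct (Nat.eqb_spec x y), (Nat.eqb_spec x z); try tauto.
    rewrite IHd by tauto; auto.
Qed.

(** Splits an unfolding into opening the body with a fresh variable and then filling that variable
    with the fixpoint. *)
Lemma subst_var_subst c x y s :
  ~ In y (fv c) -> ~ In y (bv c) ->
  subst (subst c x (FVar y)) y s = subst c x s.
Proof.
  induction c; intros Hf Hb; simpl in *; auto; rewrite ?in_app_iff in *;
    try (rewrite IHc1, IHc2 by tauto; reflexivity);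
    try (rewrite IHc by tauto; reflexivity).
  - destruct (Nat.eqb_spec x0 x); simpl.
    + rewrite Nat.eqb_refl; auto.
    + destruct (Nat.eqb_spec x0 y); tauto.
  - assert (Hf' : ~ In y (fv c)).
    { intros H; apply Hf, filter_In; rewrite negb_true_iff, Nat.eqb_neq.
      split; auto; intros ->; tauto. }
    destruct (Nat.eqb_spec x0 x); simpl; destruct (Nat.eqb_spec x0 y); try tauto.
    + rewrite subst_notin; auto.
    + rewrite IHc by tauto; auto.
Qed.

(** The middle alternative accounts for the parts of [d] below a binder of [z], which the
    substitution leaves alone. *)
Lemma subf_subst b d z r :
  subf b (subst d z r) ->
  subf b r \/ subf b d \/ exists b', subf b' d /\ b = subst b' z r.
Proof.
  induction d; intros H; simpl in H; auto;
    try (inversion H; subst;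
      [ right; right; eexists; split; [apply subf_refl|reflexivity]
      | match goal with IH : _ -> _, H1 : subf _ (subst ?d _ _) |- _ =>
          destruct (IH H1) as [?|[?|[b' [? ?]]]] end; eauto 6 using subf
      | match goal with IH : subf _ (subst ?d _ _) -> _, H1 : subf _ (subst ?d _ _) |- _ =>
          destruct (IH H1) as [?|[?|[b' [? ?]]]] end; eauto 6 using subf ]);
    try (inversion H; subst;
      [ right; right; eexists; split; [apply subf_refl|reflexivity]
      | match goal with IH : _ -> _, H1 : subf _ (subst ?d _ _) |- _ =>
          destruct (IH H1) as [?|[?|[b' [? ?]]]] end; eauto 6 using subf ]).
  - destruct (Nat.eqb_spec x z); auto.
  - destruct (Nat.eqb_spec x z) as [|Hn]; auto.
    inversion H; subst.
    + right; right; exists (FFix e x d); split; [apply subf_refl|].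
      simpl; destruct (Nat.eqb_spec x z); congruence.
    + destruct (IHd H1) as [?|[?|[b' [? ?]]]]; eauto 6 using subf.
Qed.

(** * Traces *)

Lemma step_fv f g v : step f g -> In v (fv g) -> In v (fv f).
Proof.
  intros H Hv; destruct H; simpl; rewrite ?in_app_iff; auto.
  apply fv_subst in Hv; destruct Hv as [Hv|Hv]; auto.
  apply in_fv_fix; auto.
Qed.

Lemma step_bv f g v : step f g -> In v (bv g) -> In v (bv f).
Proof.
  intros H Hv; destruct H; simpl; rewrite ?in_app_iff; auto.
  apply bv_subst in Hv; destruct Hv as [Hv|Hv]; auto.
Qed.

Lemma step_tidy f g : step f g -> tidy f -> tidy g.
Proof.
  intros H Ht v Hv Hb; apply (Ht v); eauto using step_fv, step_bv.
Qed.

Lemma step_len f g : step f g -> ~ is_fix f -> len g < len f.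
Proof. destruct 1; simpl; try lia; tauto. Qed.

Lemma step_not_atomic f g : step f g -> ~ atomic f.
Proof. destruct 1; simpl; auto. Qed.

Lemma Clos_step f g h : Clos f g -> step g h -> Clos f h.
Proof. intros; eapply rt_trans; [eassumption|apply rt_step; auto]. Qed.

Lemma Clos_ind_l (P : formula -> Prop) f :
  P f -> (forall g h, Clos f g -> P g -> step g h -> P h) ->
  forall g, Clos f g -> P g.
Proof.
  intros H0 Hs g Hg; apply clos_rt_rtn1 in Hg; induction Hg; auto.
  apply (Hs y); auto. apply clos_rtn1_rt; auto.
Qed.

Lemma Clos_tidy f g : Clos f g -> tidy f -> tidy g.
Proof. intros H Ht; revert g H; apply Clos_ind_l; eauto using step_tidy. Qed.

Lemma Clos_atomic f g : atomic f -> Clos f g -> g = f.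
Proof.
  intros Ha; revert g; apply Clos_ind_l; auto.
  intros g h _ -> H; apply step_not_atomic in H; tauto.
Qed.

Lemma Clos_cases f g : Clos f g -> f = g \/ exists h, step f h /\ Clos h g.
Proof.
  intros H; apply clos_rt_rt1n in H; destruct H; auto.
  right; exists y; split; auto; apply clos_rt1n_rt; auto.
Qed.

(* Closed under steps, and strong enough for substitution of [s] for [y] to
   commute with unfolding. *)
Definition bv_avoids (y : nat) (s c : formula) : Prop :=
  forall v, In v (bv c) -> v <> y /\ ~ In v (fv s).

Lemma bv_avoids_step y s c d : bv_avoids y s c -> step c d -> bv_avoids y s d.
Proof. intros H Hs v Hv; apply H; eauto using step_bv. Qed.

Lemma bv_avoids_Clos y s c d : bv_avoids y s c -> Clos c d -> bv_avoids y s d.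
Proof. intros H Hc; revert d Hc; apply Clos_ind_l; eauto using bv_avoids_step. Qed.

Lemma unfold_subst y s e z d : bv_avoids y s (FFix e z d) ->
  subst (subst d z (FFix e z d)) y s =
  subst (subst d y s) z (FFix e z (subst d y s)).
Proof.
  intros H; destruct (H z) as [H1 H2]; [simpl; auto|].
  rewrite subst_comm; auto.
  - simpl; destruct (Nat.eqb_spec z y); congruence.
  - intros Hy; destruct (H y); simpl; auto.
Qed.

Lemma step_subst y s c d :
  bv_avoids y s c -> step c d -> step (subst c y s) (subst d y s).
Proof.
  intros H Hs; destruct Hs; simpl; try constructor.
  destruct (H x) as [H1 H2]; [simpl; auto|].
  destruct (Nat.eqb_spec x y); [tauto|].
  rewrite unfold_subst by auto; constructor.
Qed.

Lemma step_subst_inv y s c f :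
  bv_avoids y s c -> c <> FVar y -> step (subst c y s) f ->
  exists d, step c d /\ f = subst d y s.
Proof.
  intros H Hc Hs; destruct c; simpl in Hs;
    try (inversion Hs; subst; eauto using step; fail).
  - destruct (Nat.eqb_spec x y); [congruence|inversion Hs].
  - destruct (H x) as [H1 H2]; [simpl; auto|].
    destruct (Nat.eqb_spec x y); [tauto|].
    inversion Hs; subst f; eexists; split; [constructor|].
    rewrite unfold_subst by auto; auto.
Qed.

Lemma Clos_subst_lift y s c d :
  bv_avoids y s c -> Clos c d -> Clos (subst c y s) (subst d y s).
Proof.
  intros H Hc; revert d Hc; apply Clos_ind_l; [apply rt_refl|].
  intros g h Hg IH Hs; eapply Clos_step; [eassumption|].
  apply step_subst; auto. eapply bv_avoids_Clos; eauto.
Qed.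

(** A trace from [c[s/y]] copies a trace from [c] until that trace stands at the hole [y]; from
    there on it is a trace from [s]. Excluding [d = FVar y] makes [d] and its instance have the same
    outermost operator. *)
Lemma Clos_subst y s c f :
  bv_avoids y s c -> Clos (subst c y s) f ->
  (exists d, Clos c d /\ d <> FVar y /\ f = subst d y s) \/ Clos s f.
Proof.
  intros H.
  assert (Hv : forall d, Clos c d ->
    (exists d', Clos c d' /\ d' <> FVar y /\ subst d y s = subst d' y s) \/
    Clos s (subst d y s)).
  { intros d Hd; destruct (excluded_middle_informative (d = FVar y)) as [->|Hn].
    - right; simpl; rewrite Nat.eqb_refl; apply rt_refl.
    - left; eauto. }
  revert f; apply Clos_ind_l; [apply Hv, rt_refl|].
  intros g h _ [[d [Hd [Hn ->]]]|Hg] Hs.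
  - apply step_subst_inv in Hs as [d' [Hs ->]]; eauto using bv_avoids_Clos.
    apply Hv; eauto using Clos_step.
  - right; eauto using Clos_step.
Qed.

(** As in [Clos_subst], except that a trace arriving at the hole is back at the fixpoint itself and
    starts again. *)
Lemma Clos_fix e x c y f :
  ~ In y (fv c) -> ~ In y (bv c) -> y <> x -> tidy (FFix e x c) ->
  Clos (FFix e x c) f ->
  f = FFix e x c \/
  exists d, Clos (subst c x (FVar y)) d /\ d <> FVar y /\
            f = subst d y (FFix e x c).
Proof.
  intros Hf Hb Hyx Ht.
  set (p := FFix e x c); set (c' := subst c x (FVar y)).
  assert (Hc' : bv_avoids y p c').
  { intros v Hv; unfold c' in Hv; rewrite bv_subst_var in Hv; split.
    - intros ->; auto.
    - intros Hv'; apply (Ht v Hv'); simpl; auto. }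
  assert (Hv : forall d, Clos c' d -> subst d y p = p \/
    exists d', Clos c' d' /\ d' <> FVar y /\ subst d y p = subst d' y p).
  { intros d Hd; destruct (excluded_middle_informative (d = FVar y)) as [->|Hn].
    - left; simpl; rewrite Nat.eqb_refl; auto.
    - right; eauto. }
  revert f; apply Clos_ind_l; auto.
  intros g h _ [->|[d [Hd [Hn ->]]]] Hs.
  - inversion Hs; subst.
    fold p; rewrite <- (subst_var_subst c x y p) by auto.
    apply (Hv c'), rt_refl.
  - apply step_subst_inv in Hs as [d' [Hs ->]]; eauto using bv_avoids_Clos.
    apply Hv; eauto using Clos_step.
Qed.

Lemma tidy_body_var e x c y :
  ~ In y (bv c) -> tidy (FFix e x c) -> tidy (subst c x (FVar y)).
Proof.
  intros Hy Ht v Hv; rewrite bv_subst_var; intros Hb.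
  apply fv_subst in Hv; destruct Hv as [Hv|Hv].
  - simpl in Hv; destruct Hv as [->|[]]; auto.
  - apply (Ht v); [apply in_fv_fix; auto|simpl; auto].
Qed.

(** Induction on length: steps from other formulas shorten, and the closure of a fixpoint consists
    of itself and instances of the closure of its opened body, which is one node shorter. *)
Lemma Clos_finite f : tidy f -> exists l, forall g, Clos f g -> In g l.
Proof.
  remember (len f) as n eqn:Hn; revert f Hn.
  induction n as [n IH] using lt_wf_ind; intros f -> Ht.
  assert (Hs : forall g, step f g -> ~ is_fix f ->
    exists l, forall h, Clos g h -> In h l).
  { intros g Hg Hf; apply (IH (len g)); auto using step_len; eauto using step_tidy. }
  destruct f as [| |p|p|x|a b|a b|a|a|e x a].
  1-5: (eexists [_]; intros g Hg; apply Clos_atomic in Hg; [left; symmetry; exact Hg|simpl; auto]).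
  1,2: (destruct (Hs a) as [l1 H1]; [constructor|simpl; auto|];
    destruct (Hs b) as [l2 H2]; [constructor|simpl; auto|];
    eexists (_ :: l1 ++ l2); intros g Hg; apply Clos_cases in Hg;
    destruct Hg as [<-|[h [Hh Hg]]]; [left; reflexivity|right];
    apply in_or_app; inversion Hh; subst; auto).
  1,2: (destruct (Hs a) as [l1 H1]; [constructor|simpl; auto|];
    eexists (_ :: l1); intros g Hg; apply Clos_cases in Hg;
    destruct Hg as [<-|[h [Hh Hg]]]; [left; reflexivity|right];
    inversion Hh; subst; auto).
  destruct (fresh_var (x :: fv a ++ bv a)) as [y Hy]; simpl in Hy.
  rewrite in_app_iff in Hy.
  destruct (IH (len a)) with (f := subst a x (FVar y)) as [l Hl]; simpl; auto.
  - rewrite len_subst_var; auto.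
  - eapply tidy_body_var; eauto.
  - exists (FFix e x a :: map (fun d => subst d y (FFix e x a)) l).
    intros g Hg; apply (Clos_fix e x a y) in Hg; auto.
    destruct Hg as [->|[d [Hd [_ ->]]]]; [left; auto|right].
    apply (in_map (fun d => subst d y (FFix e x a))); auto.
Qed.

Lemma formula_eq_dec (f g : formula) : {f = g} + {f <> g}.
Proof. repeat decide equality. Qed.

(** * The closure order by lengths *)

Definition lreach (n : nat) : formula -> formula -> Prop :=
  clos_refl_trans formula (fun a b => step a b /\ n <= len b).

Definition lcsub (f g : formula) : Prop :=
  is_fix f /\ is_fix g /\ lreach (len g) g f.

Lemma lreach_Clos n f g : lreach n f g -> Clos f g.
Proof.
  induction 1 as [a b [H _]| |]; [apply rt_step; auto|apply rt_refl|].
  eapply rt_trans; eauto.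
Qed.

Lemma lreach_le n m f g : m <= n -> lreach n f g -> lreach m f g.
Proof.
  intros Hm; induction 1 as [a b [H Hl]| |];
    [apply rt_step; split; auto; lia|apply rt_refl|eapply rt_trans; eauto].
Qed.

Lemma lreach_len n f g : n <= len f -> lreach n f g -> n <= len g.
Proof.
  intros Hf H; apply clos_rt_rtn1 in H; inversion H; subst; auto; tauto.
Qed.

Lemma lreach_ind_l n (P : formula -> Prop) f :
  P f -> (forall g h, P g -> step g h -> n <= len h -> P h) ->
  forall g, lreach n f g -> P g.
Proof.
  intros H0 Hs g Hg; apply clos_rt_rtn1 in Hg.
  induction Hg as [|b c [H1 H2] _ IH]; eauto.
Qed.

Lemma fsub_len f g : fsub f g -> len f <= len g.
Proof. intros [c [y [-> [Hy _]]]]; apply len_subst_ge; auto. Qed.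

Lemma crt_lreach psi f g : crt psi f g -> lreach (len psi) f g.
Proof.
  intros [_ H]; induction H as [a b [H Hl]| |];
    [apply rt_step; auto using fsub_len|apply rt_refl|eapply rt_trans; eauto].
Qed.

Lemma csub_lcsub f g : csub f g -> lcsub f g.
Proof. intros [Hf [Hg H]]; repeat split; auto using crt_lreach. Qed.

(** Since [g] lies on the trace from [h], it is at least as long as [h], and a trace staying above
    [len g] stays above [len h]. *)
Lemma lcsub_trans f g h : lcsub f g -> lcsub g h -> lcsub f h.
Proof.
  intros [Hf [Hg H1]] [_ [Hh H2]]; split; [auto|split; [auto|]].
  eapply rt_trans; [eassumption|].
  eapply lreach_le; [|eassumption]. eapply lreach_len; eauto.
Qed.

(* Along a trace from [FFix e x chi], [rho] is the current formula with the
   copies of the fixpoint replaced by the fresh variable [y].  A formula that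
   loses [y] was never built by unfolding, hence is a subformula of [chi]. *)
Record residual (e : fop) (x : nat) (chi : formula) (y : nat) (rho : formula)
  : Prop := {
  res_var : In y (fv rho);
  res_bv : incl (bv rho) (bv (FFix e x chi));
  res_fv : forall v, In v (fv rho) -> v = y \/ In v (fv (FFix e x chi));
  res_sub : forall b, subf b rho -> ~ In y (fv b) -> subf b chi }.

Section Residual.
Variables (e : fop) (x : nat) (chi : formula) (y : nat).
Let psi := FFix e x chi.
Hypothesis Ht : tidy psi.
Hypothesis Hy : ~ In y (x :: fv chi ++ bv chi).

Let Hyx : y <> x. Proof. intros ->; apply Hy; left; auto. Qed.
Let Hyf : ~ In y (fv chi). Proof. intros H; apply Hy; right; apply in_or_app; auto. Qed.
Let Hyb : ~ In y (bv chi). Proof. intros H; apply Hy; right; apply in_or_app; auto. Qed.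

Lemma residual_start : residual e x chi y (FVar y).
Proof.
  split; simpl.
  - auto.
  - intros v Hv; contradiction.
  - intros v [->|[]]; auto.
  - intros b Hb Hn; inversion Hb; subst; simpl in Hn; tauto.
Qed.

Lemma residual_avoids rho : residual e x chi y rho -> bv_avoids y psi rho.
Proof.
  intros H v Hv; apply (res_bv _ _ _ _ _ H) in Hv; split.
  - intros ->; simpl in Hv; destruct Hv as [Hv|Hv]; congruence.
  - intros Hv'; apply (Ht v); auto.
Qed.

(** Unfolding [rho] inserts copies of [rho], in which [y] is free. A subformula of the result
    without [y] therefore contains no such copy and was present before. *)
Lemma residual_step rho rho' : residual e x chi y rho -> step rho rho' ->
  residual e x chi y rho' \/ (subst rho' y psi = rho' /\ subf rho' chi).
Proof.
  intros H Hs.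
  assert (Hq : forall b, subf b rho' -> ~ In y (fv b) -> subf b chi).
  { pose proof (residual_avoids _ H) as Ha.
    destruct H as [Hv _ _ Hq]; destruct Hs;
      try (intros b' Hb'; apply Hq; auto using subf; fail).
    intros b Hb Hn; apply subf_subst in Hb.
    destruct Hb as [Hb|[Hb|[b' [Hb ->]]]]; auto using subf.
    destruct (in_dec Nat.eq_dec x0 (fv b')) as [Hx|Hx].
    - exfalso; apply Hn, fv_subst_new; auto.
      intros Hb'; destruct (Ha y) as [H0 _]; [|congruence].
      simpl; right; apply (subf_bv _ _ Hb); auto.
    - rewrite subst_notin in * by auto; auto using subf. }
  destruct (in_dec Nat.eq_dec y (fv rho')) as [Hv|Hv].
  - left; split; auto.
    + intros v Hv'; apply (res_bv _ _ _ _ _ H); eauto using step_bv.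
    + intros v Hv'; apply (res_fv _ _ _ _ _ H); eauto using step_fv.
  - right; split; [apply subst_notin; auto|apply Hq; auto using subf].
Qed.

(** The second case is the vacuous fixpoint, whose first step already leaves it for good. *)
Lemma residual_unfold :
  residual e x chi y (subst chi x (FVar y)) \/ subst chi x psi = chi.
Proof.
  destruct (in_dec Nat.eq_dec x (fv chi)) as [Hx|Hx].
  - left; split.
    + apply fv_subst_new; simpl; auto.
    + rewrite bv_subst_var; intros v Hv; simpl; auto.
    + intros v Hv; apply fv_subst in Hv; destruct Hv as [Hv|Hv].
      * simpl in Hv; destruct Hv as [->|[]]; auto.
      * right; apply in_fv_fix; auto.
    + intros b Hb Hn; apply subf_subst in Hb.
      destruct Hb as [Hb|[Hb|[b' [Hb ->]]]]; auto.
      * inversion Hb; subst; simpl in Hn; tauto.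
      * destruct (in_dec Nat.eq_dec x (fv b')) as [Hx'|Hx'].
        -- exfalso; apply Hn, fv_subst_new; simpl; auto.
           intros Hb'; apply Hyb, (subf_bv _ _ Hb); auto.
        -- rewrite subst_notin in * by auto; auto.
  - right; apply subst_notin; auto.
Qed.

Lemma residual_trace f g : (exists rho, f = subst rho y psi /\ residual e x chi y rho) ->
  step f g ->
  (exists rho, g = subst rho y psi /\ residual e x chi y rho) \/ subf g chi.
Proof.
  intros [rho [-> H]] Hs.
  destruct (excluded_middle_informative (rho = FVar y)) as [->|Hn].
  - simpl in Hs; rewrite Nat.eqb_refl in Hs; inversion Hs; subst.
    fold psi; destruct residual_unfold as [Hr|Hr].
    + left; eexists; split; [|exact Hr]. rewrite subst_var_subst; auto.
    + right; rewrite Hr; apply subf_refl.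
  - apply step_subst_inv in Hs as [rho' [Hs ->]]; auto using residual_avoids.
    apply residual_step in Hs as [Hr|[-> Hr]]; eauto.
Qed.

Lemma residual_len rho : residual e x chi y rho -> len psi <= len (subst rho y psi).
Proof. intros H; apply len_subst_ge, H. Qed.

Lemma lreach_residual f : lreach (len psi) psi f ->
  exists rho, f = subst rho y psi /\ residual e x chi y rho.
Proof.
  revert f; apply lreach_ind_l.
  - exists (FVar y); split; [simpl; rewrite Nat.eqb_refl; auto|apply residual_start].
  - intros g h Hg Hs Hl; destruct (residual_trace _ _ Hg Hs) as [Hh|Hh]; auto.
    apply subf_len in Hh; unfold psi in Hl; simpl in Hl; lia.
Qed.

Lemma residual_fsub rho : residual e x chi y rho -> fsub psi (subst rho y psi).
Proof.
  intros H; exists rho, y; split; [auto|split; [apply H|]].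
  assert (Ha : forall v, In v (bv rho) -> ~ In v (fv psi))
    by (intros v Hv; apply (residual_avoids _ H v Hv)).
  clear H; induction rho; simpl in *; auto;
    try (split; [apply IHrho1|apply IHrho2]; intros v Hv; apply Ha, in_or_app; auto).
  destruct (Nat.eqb_spec x0 y); auto.
Qed.
End Residual.

Lemma lcsub_csub f g : tidy g -> lcsub f g -> csub f g.
Proof.
  intros Ht [Hf [Hg H]]; split; [auto|split; [auto|]].
  destruct g as [| | | | | | | | |e x chi]; try contradiction.
  destruct (fresh_var (x :: fv chi ++ bv chi)) as [y Hy].
  assert (Hfs : forall h, lreach (len (FFix e x chi)) (FFix e x chi) h ->
    fsub (FFix e x chi) h).
  { intros h Hh; destruct (lreach_residual _ _ _ _ Ht Hy _ Hh) as [rho [-> Hr]].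
    apply residual_fsub; auto. }
  split; [apply Hfs, rt_refl|].
  enough (Hc : lreach (len (FFix e x chi)) (FFix e x chi) f /\
    clos_refl_trans formula (fun a b => step a b /\ fsub (FFix e x chi) b)
      (FFix e x chi) f) by apply Hc.
  revert f H Hf; intros f H _; revert f H; apply lreach_ind_l; [split; apply rt_refl|].
  intros g h [H1 H2] Hs Hl.
  assert (H3 : lreach (len (FFix e x chi)) (FFix e x chi) h)
    by (eapply rt_trans; [exact H1|apply rt_step; auto]).
  split; auto. eapply rt_trans; [exact H2|apply rt_step; auto].
Qed.

(** Mutual comparability forces equal lengths, and a residual whose instance is no longer than the
    fixpoint is the bare hole. *)
Lemma lcsub_antisym f g : tidy g -> lcsub f g -> lcsub g f -> f = g.
Proof.
  intros Ht [Hf [Hg H1]] [_ [_ H2]].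
  assert (Hl : len f = len g).
  { assert (len g <= len f) by (eapply lreach_len; [|exact H1]; auto).
    assert (len f <= len g) by (eapply lreach_len; [|exact H2]; auto). lia. }
  destruct g as [| | | | | | | | |e x chi]; try contradiction.
  destruct (fresh_var (x :: fv chi ++ bv chi)) as [y Hy].
  destruct (lreach_residual _ _ _ _ Ht Hy _ H1) as [rho [-> Hr]].
  apply len_subst_eq in Hl; [|apply Hr].
  subst rho; simpl; rewrite Nat.eqb_refl; auto.
Qed.

(** Applied to a residual, this is the way back to its hole, and hence to the fixpoint. In the
    fixpoint case the trace is found in the opened body and lifted by substitution. *)
Lemma Clos_free_var f y : tidy f -> In y (fv f) -> Clos f (FVar y).
Proof.
  enough (forall n f, n = len f -> tidy f -> In y (fv f) -> Clos f (FVar y)) by eauto.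
  clear f; intros n.
  induction n as [n IH] using lt_wf_ind; intros f -> Ht Hy.
  assert (Hs : forall g, step f g -> ~ is_fix f -> In y (fv g) -> Clos f (FVar y)).
  { intros g Hg Hf Hv; eapply rt_trans; [apply rt_step; eassumption|].
    apply (IH (len g)); auto using step_len; eauto using step_tidy. }
  destruct f as [| |p|p|x|a b|a b|a|a|e x a]; try (simpl in Hy; contradiction).
  - simpl in Hy; destruct Hy as [->|[]]; apply rt_refl.
  - simpl in Hy; apply in_app_or in Hy; destruct Hy as [Hy|Hy];
      [apply (Hs a)|apply (Hs b)]; simpl; auto using step.
  - simpl in Hy; apply in_app_or in Hy; destruct Hy as [Hy|Hy];
      [apply (Hs a)|apply (Hs b)]; simpl; auto using step.
  - apply (Hs a); simpl; auto using step.
  - apply (Hs a); simpl; auto using step.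
  - apply in_fv_fix in Hy as [Hy Hyx].
    destruct (fresh_var (y :: x :: fv a ++ bv a)) as [z Hz]; simpl in Hz.
    rewrite in_app_iff in Hz.
    eapply rt_trans; [apply rt_step, st_fix|].
    rewrite <- (subst_var_subst a x z) by tauto.
    replace (FVar y) with (subst (FVar y) z (FFix e x a)).
    2:{ simpl; destruct (Nat.eqb_spec y z); [subst; tauto|auto]. }
    apply Clos_subst_lift.
    + intros v; rewrite bv_subst_var; intros Hv; split; [intros ->; tauto|].
      intros Hv'; apply (Ht v Hv'); simpl; auto.
    + apply (IH (len a)); simpl; auto.
      * rewrite len_subst_var; auto.
      * eapply tidy_body_var; [|exact Ht]; tauto.
      * apply fv_subst_keep; auto.
Qed.

Lemma lcsub_Clos_sym f g : tidy g -> lcsub f g -> Clos f g.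
Proof.
  intros Ht [Hf [Hg H]].
  destruct g as [| | | | | | | | |e x chi]; try contradiction.
  destruct (fresh_var (x :: fv chi ++ bv chi)) as [y Hy].
  destruct (lreach_residual _ _ _ _ Ht Hy _ H) as [rho [-> Hr]].
  pose proof (residual_avoids _ _ _ _ Ht Hy _ Hr) as Ha.
  replace (FFix e x chi) with (subst (FVar y) y (FFix e x chi)) at 2
    by (simpl; rewrite Nat.eqb_refl; auto).
  apply Clos_subst_lift; auto.
  apply Clos_free_var; [|apply Hr].
  intros v Hv Hb; apply (res_fv _ _ _ _ _ Hr) in Hv; destruct Hv as [->|Hv].
  - destruct (Ha y Hb); tauto.
  - destruct (Ha v Hb); tauto.
Qed.

Lemma lcsub_equivC f g : tidy g -> lcsub f g -> equivC f g.
Proof.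
  intros Ht H; split; [apply lcsub_Clos_sym; auto|eapply lreach_Clos, H].
Qed.

(** The trace below [c[s/y]] is an instance of a trace from [c]. If the latter dropped into a
    subformula of the body of [c], its instance would be shorter than [c[s/y]]. So it keeps length
    at least [len c], which exceeds 1, and never stands at the hole. *)
Lemma lcsub_lift y s c f :
  tidy c -> bv_avoids y s c -> is_fix c -> lcsub f (subst c y s) ->
  exists d, lcsub d c /\ f = subst d y s.
Proof.
  intros Ht Ha Hc [Hf [_ H]].
  destruct c as [| | | | | | | | |e x chi]; try contradiction.
  destruct (fresh_var (x :: fv chi ++ bv chi)) as [z Hz].
  assert (Hd : exists d, lreach (len (FFix e x chi)) (FFix e x chi) d /\ f = subst d y s).
  { clear Hf; revert f H; apply lreach_ind_l; [eexists; split; [apply rt_refl|auto]|].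
    intros g h [d [Hd ->]] Hs Hl.
    assert (Hn : d <> FVar y).
    { intros ->; apply lreach_len in Hd; auto; simpl in Hd.
      pose proof (len_pos chi); lia. }
    apply step_subst_inv in Hs as [d' [Hs ->]]; auto.
    2:{ eapply bv_avoids_Clos; [eassumption|]; eapply lreach_Clos; eauto. }
    exists d'; split; auto.
    pose proof (lreach_residual _ _ _ _ Ht Hz _ Hd) as Hr.
    destruct (residual_trace _ _ _ _ Ht Hz _ _ Hr Hs) as [[r [Hr1 Hr2]]|Hr'].
    - eapply rt_trans; [exact Hd|apply rt_step; split; auto].
      rewrite Hr1; apply residual_len; auto.
    - exfalso; apply len_subst_subf with (x := y) (s := s) in Hr'.
      + simpl in Hl; destruct (Ha x) as [Hx _]; [simpl; auto|].
        destruct (Nat.eqb_spec x y); [tauto|simpl in Hl; lia].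
      + intros Hy; destruct (Ha y); simpl; auto. }
  destruct Hd as [d [Hd ->]]; exists d; split; auto.
  split; [|split; [simpl; auto|auto]].
  destruct d; simpl in *; auto.
  apply lreach_len in Hd; auto; simpl in Hd; pose proof (len_pos chi); lia.
Qed.

(** * Alternating chains and the alternation hierarchy *)

(** Only the top formula is recorded: [lcsub_lift] pulls a chain back through a substitution from
    its top downwards. *)
Inductive chain_below : formula -> nat -> Prop :=
| chain_one f : is_fix f -> chain_below f 1
| chain_up f g n e : chain_below f n -> lcsub f g ->
    fix_type f = Some e -> fix_type g = Some (dual e) -> chain_below g (S n).

Lemma dual_dual e : dual (dual e) = e.
Proof. destruct e; auto. Qed.

Lemma dual_neq e : dual e <> e.
Proof. destruct e; discriminate. Qed.

Lemma chain_below_app l : forall f k, alt_chain (f :: l) -> chain_below f k ->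
  exists g, In g (f :: l) /\ chain_below g (k + length l).
Proof.
  induction l as [|g l IH]; intros f k Hl Hk.
  - exists f; simpl; rewrite Nat.add_0_r; auto.
  - destruct Hl as [Hf [_ [[Hs _] [[e [He1 He2]] Hl]]]].
    destruct (IH g (S k) Hl) as [h [Hh1 Hh2]].
    + eapply chain_up; eauto using csub_lcsub.
    + exists h; split; [right; auto|].
      simpl; rewrite <- plus_n_Sm; auto.
Qed.

Lemma alt_chain_below f l : alt_chain (f :: l) ->
  exists g, In g (f :: l) /\ chain_below g (length (f :: l)).
Proof.
  intros H; destruct (chain_below_app l f 1 H) as [g Hg]; eauto.
  destruct l; apply chain_one, H.
Qed.

Lemma fix_type_subst d y s : is_fix (subst d y s) -> d <> FVar y ->
  is_fix d /\ fix_type (subst d y s) = fix_type d.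
Proof.
  destruct d; simpl; auto; intros H Hn.
  - destruct (Nat.eqb_spec x y); [congruence|simpl in H; tauto].
  - destruct (Nat.eqb_spec x y); auto.
Qed.

Lemma chain_below_fix f m : chain_below f m -> is_fix f.
Proof. destruct 1; auto; apply H0. Qed.

Lemma chain_below_lift y s g m : chain_below g m ->
  forall d, g = subst d y s -> d <> FVar y -> tidy d -> bv_avoids y s d ->
  chain_below d m.
Proof.
  induction 1 as [g Hg|f g n e Hf IH Hs He1 He2]; intros d -> Hd Ht Ha.
  - apply chain_one; eapply fix_type_subst; eauto.
  - destruct (fix_type_subst d y s) as [Hfix Hty]; auto; [apply Hs|].
    destruct (lcsub_lift y s d f) as [d' [Hd' ->]]; auto.
    assert (Hcl : Clos d d') by (eapply lreach_Clos, Hd').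
    assert (Hn : d' <> FVar y) by (intros ->; apply Hd').
    eapply chain_up; [apply IH| | |]; eauto using Clos_tidy, bv_avoids_Clos.
    + rewrite <- He1; symmetry; apply fix_type_subst; auto; apply Hs.
    + congruence.
Qed.

(** * Simultaneous renaming of free variables *)

Definition updv (t : nat -> nat) (x y : nat) : nat -> nat :=
  fun v => if Nat.eqb v x then y else t v.

Fixpoint rename (t : nat -> nat) (f : formula) : formula :=
  match f with
  | FVar x => FVar (t x)
  | FAnd a b => FAnd (rename t a) (rename t b)
  | FOr a b => FOr (rename t a) (rename t b)
  | FDia a => FDia (rename t a)
  | FBox a => FBox (rename t a)
  | FFix e x a => FFix e x (rename (updv t x x) a)
  | f => f
  end.

(** At the identity renaming this is tidiness of [f]; in general it makes [rename t f] tidy. *)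
Definition no_capture (t : nat -> nat) (f : formula) : Prop :=
  forall v, In v (fv f) -> ~ In (t v) (bv f).

Lemma bv_rename f : forall t, bv (rename t f) = bv f.
Proof. induction f; intros t; simpl; auto; congruence. Qed.

Lemma fv_rename f : forall t v, In v (fv (rename t f)) ->
  exists u, In u (fv f) /\ v = t u.
Proof.
  induction f; intros t v H; try (simpl in H; contradiction).
  - simpl in *; destruct H as [<-|[]]; eauto.
  - simpl in *; apply in_app_or in H; destruct H as [H|H];
      [apply IHf1 in H|apply IHf2 in H]; destruct H as [u [Hu ->]];
      exists u; rewrite in_app_iff; auto.
  - simpl in *; apply in_app_or in H; destruct H as [H|H];
      [apply IHf1 in H|apply IHf2 in H]; destruct H as [u [Hu ->]];
      exists u; rewrite in_app_iff; auto.
  - apply (IHf t v H).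
  - apply (IHf t v H).
  - simpl rename in H; apply in_fv_fix in H as [H Hv]; apply IHf in H as [u [Hu ->]].
    unfold updv in *; destruct (Nat.eqb_spec u x); [congruence|].
    exists u; rewrite in_fv_fix; auto.
Qed.

Lemma rename_ext f : forall t t', (forall v, In v (fv f) -> t v = t' v) ->
  rename t f = rename t' f.
Proof.
  induction f; intros t t' H; simpl; auto;
    try (simpl in H; erewrite IHf1, IHf2; [reflexivity| |]; intros v Hv;
         apply H, in_or_app; auto; fail);
    try (erewrite IHf; [reflexivity|]; auto; fail).
  - rewrite H; simpl; auto.
  - erewrite IHf; [reflexivity|]; intros v Hv; unfold updv.
    destruct (Nat.eqb_spec v x); auto. apply H, in_fv_fix; auto.
Qed.

Lemma rename_id f : forall t, (forall v, t v = v) -> rename t f = f.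
Proof.
  induction f; intros t H; simpl; rewrite ?IHf1, ?IHf2, ?IHf; auto.
  intros v; unfold updv; destruct (Nat.eqb_spec v x); auto.
Qed.

Lemma rename_tidy t f : no_capture t f -> tidy (rename t f).
Proof.
  intros H v Hv; rewrite bv_rename; apply fv_rename in Hv as [u [Hu ->]]; auto.
Qed.

(** Opening the body of a renamed fixpoint is again a renaming of the body, to which an induction
    hypothesis over all renamings applies. *)
Lemma rename_subst_var c x y : forall t, (forall v, In v (fv c) -> v <> x -> t v <> x) ->
  subst (rename (updv t x x) c) x (FVar y) = rename (updv t x y) c.
Proof.
  induction c; intros t H; simpl; auto;
    try (simpl in H; erewrite IHc1, IHc2; [reflexivity| |]; intros v Hv;
         apply H, in_or_app; auto; fail);
    try (erewrite IHc; [reflexivity|]; auto; fail).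
  - unfold updv; destruct (Nat.eqb_spec x0 x) as [->|Hn].
    + rewrite Nat.eqb_refl; auto.
    + destruct (Nat.eqb_spec (t x0) x) as [E|]; auto.
      exfalso; revert E; apply H; simpl; auto.
  - destruct (Nat.eqb_spec x0 x) as [->|Hn]; f_equal.
    + apply rename_ext; intros v _; unfold updv.
      destruct (Nat.eqb_spec v x); auto.
    + replace (rename (updv (updv t x x) x0 x0) c)
        with (rename (updv (updv t x0 x0) x x) c)
        by (apply rename_ext; intros v _; unfold updv;
            destruct (Nat.eqb_spec v x), (Nat.eqb_spec v x0); congruence).
      rewrite IHc.
      * apply rename_ext; intros v _; unfold updv;
          destruct (Nat.eqb_spec v x), (Nat.eqb_spec v x0); congruence.
      * intros v Hv Hvx; unfold updv; destruct (Nat.eqb_spec v x0); auto.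
        apply H; auto. apply in_fv_fix; auto.
Qed.

Lemma rename_subst_notin c x y s t : ~ In x (fv c) ->
  (forall v, In v (fv c) -> v <> x -> t v <> y) ->
  subst (rename (updv t x y) c) y s = rename t c.
Proof.
  intros Hx H; rewrite subst_notin.
  - apply rename_ext; intros v Hv; unfold updv; destruct (Nat.eqb_spec v x); congruence.
  - intros Hy; apply fv_rename in Hy as [u [Hu E]]; unfold updv in E.
    destruct (Nat.eqb_spec u x) as [->|Hn]; [tauto|].
    symmetry in E; revert E; apply H; auto.
Qed.

(** The variable [x] may also occur bound in [c]. Sending its free occurrences to a new [y] turns
    the instance into one whose hole is never bound. *)
Lemma rename_subst c x y s : forall t, free_for s x c -> ~ In y (bv c) ->
  (forall v, In v (fv c) -> v <> x -> t v <> y) ->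
  rename t (subst c x s) = subst (rename (updv t x y) c) y (rename t s).
Proof.
  induction c; intros t Hff Hy H; simpl; auto;
    try (simpl in *; rewrite in_app_iff in Hy; rewrite IHc1, IHc2; auto;
         try tauto; intros v Hv; apply H, in_or_app; auto; fail);
    try (simpl in *; rewrite IHc; auto; fail).
  - unfold updv; destruct (Nat.eqb_spec x0 x) as [->|Hn]; simpl.
    + rewrite Nat.eqb_refl; auto.
    + destruct (Nat.eqb_spec (t x0) y) as [E|]; auto.
      exfalso; revert E; apply H; simpl; auto.
  - destruct (in_dec Nat.eq_dec x (fv (FFix e x0 c))) as [Hx|Hx].
    2:{ transitivity (rename t (subst (FFix e x0 c) x s)); [reflexivity|].
        rewrite (subst_notin (FFix e x0 c)) by auto; symmetry.
        apply (rename_subst_notin (FFix e x0 c) x y (rename t s) t); auto. }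
    apply in_fv_fix in Hx as [Hx Hxx]. simpl in Hff, Hy.
    destruct (Nat.eqb_spec x0 x) as [->|Hn]; [congruence|].
    destruct (Nat.eqb_spec x0 y) as [->|Hn']; [tauto|].
    simpl; f_equal; rewrite IHc; try tauto.
    + f_equal; apply rename_ext; intros v Hv; unfold updv.
      * destruct (Nat.eqb_spec v x), (Nat.eqb_spec v x0); congruence.
      * destruct (Nat.eqb_spec v x0) as [->|]; tauto.
    + intros v Hv Hvx; unfold updv; destruct (Nat.eqb_spec v x0); [congruence|].
      apply H; auto; apply in_fv_fix; auto.
Qed.

Lemma fv_subst_free c x s v :
  In x (fv c) -> free_for s x c -> In v (fv s) -> In v (fv (subst c x s)).
Proof.
  induction c; intros H Hff Hv;
    try (simpl in *; rewrite ?in_app_iff in *; tauto).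
  - simpl in *; destruct H as [->|[]]; rewrite Nat.eqb_refl; auto.
  - simpl subst; rewrite in_fv_fix in H; simpl in Hff.
    destruct (Nat.eqb_spec x0 x) as [->|Hn]; [tauto|].
    rewrite in_fv_fix; split; [tauto|]; intros ->; tauto.
Qed.

(** The invariant of [AH e n]: this class is closed under fixpoints of type [dual e] at no cost, so
    a chain with top of type [dual e] may be one longer than a chain with top of type [e]. *)
Definition chain_bound (e : fop) (n : nat) (f : formula) : Prop :=
  forall g m, Clos f g -> chain_below g m ->
    (fix_type g = Some e -> m <= n) /\ m <= S n.

Lemma chain_bound_step e n f : ~ is_fix f ->
  (forall g, step f g -> chain_bound e n g) -> chain_bound e n f.
Proof.
  intros Hf H g m Hg Hm; apply Clos_cases in Hg as [<-|[h [Hs Hg]]].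
  - apply chain_below_fix in Hm; tauto.
  - eapply H; eauto.
Qed.

(** The new fixpoint is the only formula of its closure that is not an instance from the opened
    body. In a chain leading up to it, the preceding formula has type [e], hence is such an instance
    and tops a chain of length at most [n]. *)
Lemma chain_bound_fix e n x c y :
  ~ In y (x :: fv c ++ bv c) -> tidy (FFix (dual e) x c) ->
  chain_bound e n (subst c x (FVar y)) -> chain_bound e n (FFix (dual e) x c).
Proof.
  intros Hy Ht IH; simpl in Hy; rewrite in_app_iff in Hy.
  set (p := FFix (dual e) x c) in *.
  assert (Ha : bv_avoids y p (subst c x (FVar y))).
  { intros v Hv; rewrite bv_subst_var in Hv; split; [intros ->; tauto|].
    intros Hv'; apply (Ht v Hv'); simpl; auto. }
  assert (Ht' : tidy (subst c x (FVar y)))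
    by (eapply tidy_body_var; [|exact Ht]; tauto).
  assert (Hlift : forall d m, Clos (subst c x (FVar y)) d -> d <> FVar y ->
    chain_below (subst d y p) m ->
    (fix_type (subst d y p) = Some e -> m <= n) /\ m <= S n).
  { intros d m Hd Hn Hm.
    assert (Hm' : chain_below d m)
      by (eapply chain_below_lift; eauto using Clos_tidy, bv_avoids_Clos).
    destruct (fix_type_subst d y p) as [_ ->];
      [eapply chain_below_fix; eauto|auto|eapply IH; eauto]. }
  intros g m Hg Hm.
  apply (Clos_fix _ _ _ y) in Hg; try tauto.
  2:{ intros ->; tauto. }
  destruct Hg as [->|[d [Hd [Hn ->]]]]; [|apply Hlift; auto].
  split; [simpl; intros E; injection E as E; apply dual_neq in E; tauto|].
  inversion Hm as [|f g n' e' Hf Hs He1 He2]; subst; [lia|].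
  assert (He : e' = e).
  { simpl in He2; injection He2 as He2.
    rewrite <- (dual_dual e'), <- (dual_dual e); congruence. }
  subst e'; apply le_n_S.
  assert (Hc : Clos p f) by (eapply lreach_Clos, Hs).
  apply (Clos_fix _ _ _ y) in Hc; try tauto.
  2:{ intros ->; tauto. }
  destruct Hc as [->|[d [Hd [Hn ->]]]].
  - simpl in He1; injection He1 as E; apply dual_neq in E; tauto.
  - eapply Hlift; eauto.
Qed.

Lemma chain_bound_subst e n y c s :
  tidy c -> bv_avoids y s c -> chain_bound e n c -> chain_bound e n s ->
  chain_bound e n (subst c y s).
Proof.
  intros Ht Ha Hc Hs g m Hg Hm.
  destruct (Clos_subst _ _ _ _ Ha Hg) as [[d [Hd [Hn ->]]]|Hg']; [|eapply Hs; eauto].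
  assert (Hm' : chain_below d m)
    by (eapply chain_below_lift; eauto using Clos_tidy, bv_avoids_Clos).
  destruct (fix_type_subst d y s) as [_ ->];
    [eapply chain_below_fix; eauto|auto|eapply Hc; eauto].
Qed.

(** The premise of [AH_up] nests [AH] in a disjunction; this principle provides the induction
    hypothesis beneath it. *)
Lemma AH_nested_ind (P : fop -> nat -> formula -> Prop) :
  (forall e a, atomic a -> P e 0 a) ->
  (forall e n a b, P e n a -> P e n b -> P e n (FAnd a b)) ->
  (forall e n a b, P e n a -> P e n b -> P e n (FOr a b)) ->
  (forall e n a, P e n a -> P e n (FDia a)) ->
  (forall e n a, P e n a -> P e n (FBox a)) ->
  (forall e n x c, P e n c -> P e n (FFix (dual e) x c)) ->
  (forall e n c x s, P e n c -> P e n s -> free_for s x c -> P e n (subst c x s)) ->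
  (forall e e' n f, P e' n f -> P e (S n) f) ->
  forall e n f, AH e n f -> P e n f.
Proof.
  intros H1 H2 H3 H4 H5 H6 H7 H8.
  fix IH 4; intros e n f H; destruct H; auto.
  destruct H as [H|H]; eapply H8; apply IH, H.
Qed.

(* The derivation of a tidy formula may pass through formulas that are not
   tidy; quantifying over renamings of the free variables repairs this. *)
Lemma AH_chain_bound e n f : AH e n f ->
  forall t, no_capture t f -> chain_bound e n (rename t f).
Proof.
  induction 1 as [e a Ha|e n a b IH1 IH2|e n a b IH1 IH2|e n a IH|e n a IH
    |e n x c IH|e n c x s IH1 IH2 Hff|e e' n f IH] using AH_nested_ind; intros t Ht.
  - intros g m Hg Hm; assert (Ha' : atomic (rename t a)) by (destruct a; auto).
    apply Clos_atomic in Hg; auto; subst g.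
    apply chain_below_fix in Hm; destruct a; simpl in *; tauto.
  - assert (Ha : chain_bound e n (rename t a)).
    { apply IH1; intros v Hv Hb; apply (Ht v); simpl; apply in_or_app; auto. }
    assert (Hb : chain_bound e n (rename t b)).
    { apply IH2; intros v Hv Hb; apply (Ht v); simpl; apply in_or_app; auto. }
    apply chain_bound_step; simpl; auto. intros g Hg; inversion Hg; subst; auto.
  - assert (Ha : chain_bound e n (rename t a)).
    { apply IH1; intros v Hv Hb; apply (Ht v); simpl; apply in_or_app; auto. }
    assert (Hb : chain_bound e n (rename t b)).
    { apply IH2; intros v Hv Hb; apply (Ht v); simpl; apply in_or_app; auto. }
    apply chain_bound_step; simpl; auto. intros g Hg; inversion Hg; subst; auto.
  - apply chain_bound_step; simpl; auto. intros g Hg; inversion Hg; subst; auto.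
  - apply chain_bound_step; simpl; auto. intros g Hg; inversion Hg; subst; auto.
  - pose proof (rename_tidy _ _ Ht) as Htidy; simpl in Htidy |- *.
    set (c' := rename (updv t x x) c) in *.
    destruct (fresh_var (x :: fv c' ++ bv c')) as [y Hy].
    apply chain_bound_fix with (y := y); auto.
    unfold c'; rewrite rename_subst_var.
    + apply IH; intros v Hv; unfold updv; destruct (Nat.eqb_spec v x) as [->|Hn].
      * intros Hb; apply Hy; right; apply in_or_app; right.
        unfold c'; rewrite bv_rename; auto.
      * intros Hb; apply (Ht v); [apply in_fv_fix; auto|simpl; auto].
    + intros v Hv Hn E; apply (Ht v); [apply in_fv_fix; auto|simpl; auto].
  - destruct (in_dec Nat.eq_dec x (fv c)) as [Hx|Hx].
    2:{ rewrite subst_notin in * by auto; auto. }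
    (* The hole must differ from the renamed free variables of [c], not just from the original
       ones. *)
    destruct (fresh_var (map t (fv c) ++ bv c)) as [y Hy]; rewrite in_app_iff in Hy.
    assert (Hty : forall v, In v (fv c) -> v <> x -> t v <> y).
    { intros v Hv _ E; apply Hy; left; rewrite <- E; apply in_map; auto. }
    rewrite (rename_subst c x y s) by tauto.
    assert (Hc : no_capture (updv t x y) c).
    { intros v Hv Hb; unfold updv in Hb; destruct (Nat.eqb_spec v x); [tauto|].
      apply (Ht v); [apply fv_subst_keep|apply bv_subst_keep]; auto. }
    assert (Hfv : forall v, In v (fv s) -> In v (fv (subst c x s))).
    { intros v Hv; apply fv_subst_free; auto. }
    apply chain_bound_subst; auto using rename_tidy.
    + intros v Hv; rewrite bv_rename in Hv; split; [intros ->; tauto|].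
      intros Hv'; apply fv_rename in Hv' as [u [Hu ->]].
      apply (Ht u); auto using bv_subst_keep.
    + apply IH2; intros v Hv Hb; apply (Ht v); auto using bv_subst_new.
  (* The bound [S n] for all chains at level [n] gives the stricter bound at level [S n] for either
     type. *)
  - intros g m Hg Hm; destruct (IH t Ht g m Hg Hm) as [H1 H2]; auto.
Qed.

(** Of the two memberships, the one for the type of [g] gives [n] instead of [S n]. *)
Lemma AH_tidy_bound n f g m : tidy f -> AH FMu n f -> AH FNu n f ->
  Clos f g -> chain_below g m -> m <= n.
Proof.
  intros Ht H1 H2 Hg Hm.
  assert (Hid : no_capture (fun v => v) f) by exact Ht.
  apply (fun H => AH_chain_bound _ _ _ H _ Hid) in H1, H2.
  rewrite rename_id in H1, H2 by auto.
  pose proof (chain_below_fix _ _ Hm) as Hf.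
  destruct g as [| | | | | | | | |[] x chi]; try contradiction;
    [eapply H1|eapply H2]; eauto.
Qed.

Lemma AH_le e n m f : n <= m -> AH e n f -> AH e m f.
Proof. induction 1; auto. intros H0; apply AH_up; destruct e; auto. Qed.

(** Makes [ad] total. With one [n] serving both types, a further fixpoint of any type costs a single
    level. *)
Lemma AH_exists f : exists n, forall e, AH e n f.
Proof.
  induction f as [| |p|p|x|a [n IH1] b [m IH2]|a [n IH1] b [m IH2]
    |a [n IH]|a [n IH]|e x a [n IH]].
  1-5: exists 0; intros e; apply AH_atom; simpl; auto.
  - exists (max n m); intros e; apply AH_and; (eapply AH_le; [|first [apply IH1|apply IH2]]; lia).
  - exists (max n m); intros e; apply AH_or; (eapply AH_le; [|first [apply IH1|apply IH2]]; lia).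
  - exists n; auto using AH.
  - exists n; auto using AH.
  - exists (S n); intros e'; apply AH_up.
    assert (H : AH (dual e) n (FFix e x a))
      by (rewrite <- (dual_dual e) at 2; apply AH_fix; auto).
    destruct e; simpl in H; auto.
Qed.

(** * Priorities *)

Lemma maxP_unique P n m : maxP P n -> maxP P m -> n = m.
Proof. intros [H1 H2] [H3 H4]; apply Nat.le_antisymm; auto. Qed.

Lemma max_opt_intro P n : maxP P n -> max_opt P = Some n.
Proof.
  intros H; unfold max_opt; destruct (excluded_middle_informative _) as [He|He].
  - destruct (constructive_indefinite_description _ He) as [m Hm]; simpl.
    f_equal; eapply maxP_unique; eauto.
  - exfalso; eauto.
Qed.

Lemma bounded_maxP (P : nat -> Prop) k b :
  P k -> (forall m, P m -> m <= b) -> exists n, maxP P n.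
Proof.
  intros Hk Hb.
  assert (H : forall d m, P m -> b <= m + d -> exists n, maxP P n).
  { induction d as [|d IH]; intros m Hm Hd.
    - exists m; split; auto; intros m' Hm'; apply Hb in Hm'; lia.
    - destruct (excluded_middle_informative (exists m', P m' /\ m < m'))
        as [[m' [H1 H2]]|Hn].
      + apply (IH m'); auto; lia.
      + exists m; split; auto; intros m' Hm'.
        apply not_lt; intros Hl; apply Hn; exists m'; auto. }
  apply (H b k); auto; lia.
Qed.

Lemma least (P : nat -> Prop) n : P n -> exists m, P m /\ forall k, P k -> m <= k.
Proof.
  induction n as [n IH] using lt_wf_ind; intros Hn.
  destruct (excluded_middle_informative (exists m, P m /\ m < n)) as [[m [H1 H2]]|H].
  - eauto.
  - exists n; split; auto; intros k Hk; apply not_lt; intros Hl; eauto.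
Qed.

Lemma min_opt_intro P n : minP P n -> min_opt P = Some n.
Proof.
  intros H; unfold min_opt; destruct (excluded_middle_informative _) as [He|He].
  - destruct (constructive_indefinite_description _ He) as [m Hm]; simpl.
    destruct H as [H1 H2], Hm as [H3 H4]; f_equal; apply Nat.le_antisymm; auto.
  - exfalso; eauto.
Qed.

Lemma alt_chain_in l f g : alt_chain (f :: l) -> In g (f :: l) ->
  tidy g /\ is_fix g /\ equivC f g.
Proof.
  revert f; induction l as [|h l IH]; intros f Hl Hg.
  - destruct Hg as [<-|[]]; destruct Hl as [H1 [H2 _]].
    repeat split; auto; apply rt_refl.
  - destruct Hl as [Hf1 [Hf2 [[Hs _] [_ Hl]]]].
    destruct Hg as [<-|Hg]; [repeat split; auto; apply rt_refl|].
    destruct (IH h Hl Hg) as [H1 [H2 [H3 H4]]].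
    assert (Hh : tidy h) by (destruct l; apply Hl).
    destruct (lcsub_equivC f h Hh (csub_lcsub _ _ Hs)) as [H5 H6].
    split; [auto|split; [auto|split; eapply rt_trans; eauto]].
Qed.

(** Strictness comes from the alternation of types: by antisymmetry, mutually comparable formulas
    would be equal. *)
Lemma alt_chain_cons f g l e : tidy f -> alt_chain (g :: l) -> lcsub f g ->
  fix_type f = Some e -> fix_type g = Some (dual e) -> alt_chain (f :: g :: l).
Proof.
  intros Hf Hl Hs H1 H2.
  assert (Hg : tidy g) by (destruct l; apply Hl).
  split; [auto|split; [apply Hs|split; [split|split; eauto]]].
  - apply lcsub_csub; auto.
  - intros Hc; apply csub_lcsub in Hc.
    assert (f = g) by (apply lcsub_antisym; auto); subst g.
    rewrite H1 in H2; injection H2 as H2; symmetry in H2; apply dual_neq in H2; auto.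
Qed.

Lemma alt_chain_replace f g l e : tidy f -> alt_chain (g :: l) -> lcsub f g ->
  fix_type f = Some e -> fix_type g = Some e -> alt_chain (f :: l).
Proof.
  intros Hf Hl Hs H1 H2; destruct l as [|h l].
  - split; auto; split; auto; apply Hs.
  - destruct Hl as [Hg [_ [[Hgh _] [[e' [H3 H4]] Hl]]]].
    assert (e' = e) by congruence; subst e'.
    apply alt_chain_cons with (e := e); auto.
    eapply lcsub_trans; [exact Hs|]; apply csub_lcsub; auto.
Qed.

Section Closure.
Variables (xi : formula) (k : nat).
Hypothesis Hxi : tidy xi.
Hypothesis Hk : forall g m, Clos xi g -> chain_below g m -> m <= k.

Lemma cd_cluster_spec f : Clos xi f ->
  exists c, cd_cluster f = Some c /\ c <= k /\
    maxP (fun n => exists l, alt_chain l /\ length l = n /\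
                             forall g, In g l -> equivC g f) c.
Proof.
  intros Hf.
  assert (Hb : forall n, (exists l, alt_chain l /\ length l = n /\
    forall g, In g l -> equivC g f) -> n <= k).
  { intros n [l [Hl [<- He]]]; destruct l as [|g l]; [simpl; lia|].
    destruct (alt_chain_below _ _ Hl) as [h [Hh Hc]].
    eapply Hk; [|exact Hc]. eapply rt_trans; [exact Hf|]. apply He; auto. }
  edestruct bounded_maxP as [c Hc]; [|exact Hb|].
  - exists []; simpl; split; [auto|split; [reflexivity|intros g []]].
  - exists c; split; [apply max_opt_intro; auto|split; auto]. apply Hb, Hc.
Qed.

Lemma cd_cluster_equiv f g : Clos xi f -> equivC f g -> cd_cluster f = cd_cluster g.
Proof.
  intros Hf Hfg.
  assert (Hg : Clos xi g) by (eapply rt_trans; [exact Hf|apply Hfg]).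
  destruct (cd_cluster_spec f Hf) as [c [-> [_ [[l [H1 [H2 H3]]] Hc]]]].
  destruct (cd_cluster_spec g Hg) as [d [-> [_ [[l' [H1' [H2' H3']]] Hd]]]].
  f_equal; apply Nat.le_antisymm; [apply Hd; exists l|apply Hc; exists l'];
    split; auto; split; auto; intros h Hh;
    [destruct (H3 h Hh)|destruct (H3' h Hh)]; destruct Hfg;
    split; eapply rt_trans; eauto.
Qed.

(** A chain starting at [f] stays in the cluster of [f]. The resulting [h <= c] makes the truncated
    subtraction in [Omega_g] a genuine one. *)
Lemma h_up_spec f c : Clos xi f -> is_fix f -> cd_cluster f = Some c ->
  exists h, h_up f = Some h /\ 1 <= h <= c /\
    maxP (fun n => exists l, alt_chain (f :: l) /\ length (f :: l) = n) h.
Proof.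
  intros Hf Hfix Hc; destruct (cd_cluster_spec f Hf) as [c' [Hc' [_ [_ Hm]]]].
  assert (c' = c) by congruence; subst c'.
  assert (Hb : forall n, (exists l, alt_chain (f :: l) /\ length (f :: l) = n) -> n <= c).
  { intros n [l [Hl <-]]; apply Hm; exists (f :: l); split; auto; split; auto.
    intros g Hg; destruct (alt_chain_in _ _ _ Hl Hg) as [_ [_ [? ?]]]; split; auto. }
  assert (H1 : exists l, alt_chain (f :: l) /\ length (f :: l) = 1).
  { exists []; simpl; eauto using Clos_tidy. }
  destruct (bounded_maxP _ _ _ H1 Hb) as [h Hh].
  exists h; split; [apply max_opt_intro; auto|split; auto].
  split; [apply Hh; auto|apply Hb, Hh].
Qed.

Lemma Omega_spec f e : Clos xi f -> fix_type f = Some e ->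
  exists c h, cd_cluster f = Some c /\ h_up f = Some h /\ 1 <= h <= c /\ c <= k /\
    Omega_g f = Some (if Bool.eqb (Nat.odd (c - h)) (is_odd_type e)
                      then c - h else S (c - h)).
Proof.
  intros Hf He.
  assert (Hfix : is_fix f) by (destruct f; simpl in *; auto; discriminate).
  destruct (cd_cluster_spec f Hf) as [c [Hc [Hck _]]].
  destruct (h_up_spec f c Hf Hfix Hc) as [h [Hh [H1 _]]].
  exists c, h; split; [auto|split; [auto|split; [auto|split; [auto|]]]].
  destruct f as [| | | | | | | | |e' x chi]; simpl in He; try discriminate.
  injection He as ->; unfold Omega_g.
  destruct (excluded_middle_informative _) as [_|Hn].
  - rewrite Hc, Hh; auto.
  - exfalso; apply Hn; eauto using Clos_tidy.
Qed.

Lemma Omega_parity f e p : Clos xi f -> fix_type f = Some e ->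
  Omega_g f = Some p -> Nat.odd p = is_odd_type e.
Proof.
  intros Hf He Hp; destruct (Omega_spec f e Hf He) as [c [h [_ [_ [_ [_ H]]]]]].
  rewrite H in Hp; injection Hp as <-.
  destruct (Bool.eqb _ _) eqn:E; [apply eqb_prop; auto|].
  apply eqb_false_iff in E. rewrite Nat.odd_succ, <- Nat.negb_odd.
  destruct (Nat.odd (c - h)), (is_odd_type e); auto; congruence.
Qed.

(** A longest chain from [g] yields one from [f]: for equal types [f] replaces [g], for different
    types [f] is put in front. So the height of [f] is at least that of [g], and strictly larger if
    the types differ. *)
Lemma Omega_mono f g e e' p q : Clos xi f -> Clos xi g ->
  fix_type f = Some e -> fix_type g = Some e' -> lcsub f g ->
  Omega_g f = Some p -> Omega_g g = Some q -> p <= q.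
Proof.
  intros Hf Hg He He' Hs Hp Hq.
  assert (Hfg : equivC f g) by (apply lcsub_equivC; eauto using Clos_tidy).
  destruct (Omega_spec f e Hf He) as [c [h [Hc [Hh [H1 [_ H]]]]]].
  destruct (Omega_spec g e' Hg He') as [c' [h' [Hc' [Hh' [H1' [_ H']]]]]].
  rewrite (cd_cluster_equiv f g Hf Hfg) in Hc.
  assert (c' = c) by congruence; subst c'.
  destruct (h_up_spec f c) as [i [Hi [_ [_ Hm]]]];
    [auto|apply Hs|rewrite (cd_cluster_equiv f g); auto|].
  destruct (h_up_spec g c) as [j [Hj [_ [[l [Hl Hlen]] _]]]]; [auto|apply Hs|auto|].
  rewrite Hi in Hh; injection Hh as <-; rewrite Hj in Hh'; injection Hh' as <-.
  pose proof (Omega_parity f e p Hf He Hp) as P1.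
  pose proof (Omega_parity g e' q Hg He' Hq) as P2.
  assert (Hd : e = e' /\ j <= i \/ j < i).
  { assert (e = e' \/ e' = dual e) as [<-| ->]
      by (destruct e, e'; auto).
    - left; split; auto; rewrite <- Hlen.
      apply Hm; exists l; split; auto.
      eapply alt_chain_replace; eauto using Clos_tidy.
    - right; rewrite <- Hlen.
      apply Hm; exists (g :: l); split; auto.
      eapply alt_chain_cons; eauto using Clos_tidy. }
  rewrite H in Hp; rewrite H' in Hq; injection Hp as <-; injection Hq as <-.
  destruct Hd as [[<- Hle]|Hlt].
  (* Equal heights receive the same correction; a difference of at least one absorbs it. *)
  - assert (Hcc : c - i < c - j \/ c - i = c - j) by lia.
    destruct Hcc as [Hcc| ->]; [|auto].
    destruct (Bool.eqb _ _), (Bool.eqb _ _); lia.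
  - destruct (Bool.eqb _ _), (Bool.eqb _ _); lia.
Qed.

(** The top is a shortest formula of the cluster. It is a fixpoint, as otherwise its successor on a
    trace to [f] would be shorter and still in the cluster. Traces between members stay in the
    cluster, hence above the minimal length. *)
Lemma cluster_top f : Clos xi f -> is_fix f ->
  exists t, is_fix t /\ equivC t f /\
    forall u, is_fix u -> equivC u f -> lcsub u t.
Proof.
  intros Hf Hfix.
  destruct (least (fun n => exists t, equivC t f /\ len t = n) (len f))
    as [n [[t [Ht <-]] Hmin]].
  { exists f; split; auto; split; apply rt_refl. }
  assert (Htf : is_fix t).
  { destruct (excluded_middle_informative (is_fix t)) as [|Hn]; auto; exfalso.
    destruct Ht as [H1 H2]; destruct (Clos_cases _ _ H1) as [->|[h [Hs Hh]]]; [auto|].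
    assert (Hlt : len h < len t) by (apply step_len; auto).
    assert (len t <= len h); [|lia].
    apply Hmin; exists h; split; auto; split; auto.
    eapply Clos_step; eauto. }
  exists t; split; [auto|split; [auto|]].
  intros u Hu Huf; split; [auto|split; [auto|]].
  assert (Hut : Clos u t) by (eapply rt_trans; [apply Huf|apply Ht]).
  assert (Htu : Clos t u) by (eapply rt_trans; [apply Ht|apply Huf]).
  apply clos_rt_rtn1 in Htu; revert Hut; clear Huf Hu.
  induction Htu as [|v w Hvw Htv IH]; intros Hut; [apply rt_refl|].
  assert (Hvt : Clos v t) by (eapply rt_trans; [apply rt_step; eassumption|auto]).
  eapply rt_trans; [apply IH; auto|apply rt_step; split; auto].
  apply Hmin; exists w; split; auto; destruct Ht as [H1 H2]; split.
  - eapply rt_trans; eauto.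
  - eapply rt_trans; [exact H2|eapply Clos_step; [apply clos_rtn1_rt; eauto|auto]].
Qed.

(** At height 1 the type is that of [t], since otherwise [u, t] would be a chain. Above that, types
    alternate along a longest chain from [u]. *)
Lemma type_by_height t et : is_fix t -> fix_type t = Some et ->
  (forall u, is_fix u -> equivC u t -> lcsub u t) -> forall h u e,
  Clos xi u -> equivC u t -> fix_type u = Some e -> h_up u = Some h ->
  is_odd_type e = xorb (is_odd_type et) (Nat.even h).
Proof.
  intros Ht Het Htop; induction h as [|h IH]; intros u e Hu Hut He Hh.
  - exfalso; destruct (Omega_spec u e Hu He) as [c [h [_ [Hh' [H1 _]]]]].
    rewrite Hh in Hh'; injection Hh' as <-; lia.
  - assert (Hfix : is_fix u) by (destruct u; simpl in *; auto; discriminate).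
    destruct (cd_cluster_spec u Hu) as [c [Hc _]].
    destruct (h_up_spec u c Hu Hfix Hc) as [h' [Hh' [_ [[l [Hl Hlen]] Hm]]]].
    rewrite Hh in Hh'; injection Hh' as <-.
    assert (Htt : Clos xi t) by (eapply rt_trans; [exact Hu|apply Hut]).
    destruct l as [|g l].
    + simpl in Hlen; injection Hlen as <-; simpl; rewrite xorb_false_r.
      assert (e = et \/ et = dual e) as [->| ->] by (destruct e, et; auto); auto.
      exfalso; assert (2 <= 1); [|lia].
      apply Hm; exists [t]; split; auto.
      apply alt_chain_cons with (e := e); eauto using Clos_tidy.
      simpl; eauto using Clos_tidy.
    + destruct (alt_chain_in _ _ g Hl) as [Hgt [Hgf [Hug Hgu]]]; [right; left; auto|].
      assert (Hl' := Hl).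
      destruct Hl' as [Hut' [_ [[Hs _] [[e' [H1 H2]] Hl']]]].
      assert (e' = e) by congruence; subst e'.
      assert (Hg : Clos xi g) by exact (rt_trans _ _ _ _ _ Hu Hug).
      (* The tail of a longest chain from [u] is a longest chain from [g], since any chain from [g]
         can be prolonged by [u]. *)
      assert (Hgh : h_up g = Some h).
      { apply max_opt_intro; split.
        - exists l; split; auto; simpl in Hlen |- *; lia.
        - intros m [l' [Hl1 <-]].
          assert (length (u :: g :: l') <= S h); [|simpl in *; lia].
          apply Hm; exists (g :: l'); split; auto.
          apply alt_chain_cons with (e := e); auto; apply csub_lcsub; auto. }
      assert (Hgt' : equivC g t).
      { destruct Hut as [H3 H4]; split; eapply rt_trans; eauto. }
      pose proof (IH g (dual e) Hg Hgt' H2 Hgh) as Hd.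
      rewrite Nat.even_succ, <- Nat.negb_even.
      destruct e, (is_odd_type et), (Nat.even h); simpl in *; congruence.
Qed.

(* Within a cluster the type of [u] is determined by the parity of [h_up u],
   so that the correction by [0] or [1] in [Omega_g] is the same everywhere. *)
Lemma Omega_range f : Clos xi f -> is_fix f ->
  exists lo c, c <= k /\ forall u, is_fix u -> equivC u f ->
    forall p, Omega_g u = Some p -> lo <= p < lo + c.
Proof.
  intros Hf Hfix.
  destruct (cluster_top f Hf Hfix) as [t [Ht [Htf Htop]]].
  assert (exists et, fix_type t = Some et) as [et Het]
    by (destruct t; simpl in *; try contradiction; eauto).
  destruct (cd_cluster_spec f Hf) as [c [Hc [Hck _]]].
  (* By [type_by_height], [c - h] has the parity of the type of [u] exactly when [c] and the type of
     [t] have opposite parities, whatever [h] is. As [1 <= h <= c], the uncorrected values run from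
     0 to [c - 1]. *)
  exists (if Bool.eqb (Nat.odd c) (negb (is_odd_type et)) then 0 else 1), c.
  split; auto; intros u Hu Huf p Hp.
  assert (Hxu : Clos xi u) by (eapply rt_trans; [exact Hf|apply Huf]).
  assert (exists e, fix_type u = Some e) as [e He]
    by (destruct u; simpl in *; try contradiction; eauto).
  destruct (Omega_spec u e Hxu He) as [c' [h [Hc' [Hh [H1 [_ HO]]]]]].
  rewrite (cd_cluster_equiv u f Hxu Huf) in Hc'.
  assert (c' = c) by congruence; subst c'.
  assert (Hut : equivC u t).
  { destruct Huf, Htf; split; eapply rt_trans; eauto. }
  assert (Htop' : forall v, is_fix v -> equivC v t -> lcsub v t).
  { intros v Hv [Hv1 Hv2]; apply Htop; auto; destruct Htf; split;
      eapply rt_trans; eauto. }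
  pose proof (type_by_height t et Ht Het Htop' h u e Hxu Hut He Hh) as Hty.
  rewrite HO in Hp; injection Hp as <-.
  rewrite Nat.odd_sub, Hty by lia; rewrite <- Nat.negb_odd.
  destruct (Nat.odd c), (Nat.odd h), (is_odd_type et); simpl; lia.
Qed.

End Closure.

(** * Infinite traces *)

Lemma lreach_trace n (f : nat -> formula) N :
  (forall n, step (f n) (f (S n))) -> (forall m, N <= m -> n <= len (f m)) ->
  forall m, N <= m -> lreach n (f N) (f m).
Proof.
  intros Hs Hl m Hm; induction Hm as [|m Hm IH]; [apply rt_refl|].
  eapply rt_trans; [exact IH|apply rt_step; split; auto].
Qed.

Lemma Clos_trace (f : nat -> formula) N m :
  (forall n, step (f n) (f (S n))) -> N <= m -> Clos (f N) (f m).
Proof.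
  intros Hs Hm; apply (lreach_Clos 0), lreach_trace; auto; intros; lia.
Qed.

Lemma lreach_len_eq g f : tidy g -> is_fix g -> lreach (len g) g f ->
  len f = len g -> f = g.
Proof.
  intros Ht Hg H Hl.
  destruct g as [| | | | | | | | |e x chi]; try contradiction.
  destruct (fresh_var (x :: fv chi ++ bv chi)) as [y Hy].
  destruct (lreach_residual _ _ _ _ Ht Hy _ H) as [rho [-> Hr]].
  apply len_subst_eq in Hl; [|apply Hr].
  subst rho; simpl; rewrite Nat.eqb_refl; auto.
Qed.

(** Once the lengths have settled above their limit inferior, a formula attaining it must be a
    fixpoint, because any other step shortens. By [lreach_len_eq] each later formula of that length
    is the same one, so it recurs. *)
Lemma dominating_fixpoint (f : nat -> formula) :
  tidy (f 0) -> (forall n, step (f n) (f (S n))) ->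
  exists N, is_fix (f N) /\ (forall n, N <= n -> len (f N) <= len (f n)) /\
    (forall M, exists n, M <= n /\ f n = f N).
Proof.
  intros Ht Hs.
  destruct (Clos_finite _ Ht) as [l Hl].
  assert (Hb : forall n, len (f n) <= list_max (map len l)).
  { intros n; assert (Hm : list_max (map len l) <= list_max (map len l)) by lia.
    apply list_max_le in Hm; rewrite Forall_forall in Hm; apply Hm, in_map, Hl.
    apply (Clos_trace f 0 n); auto; lia. }
  (* [L] is the limit inferior of the lengths; it exists because the closure is finite. *)
  destruct (least (fun L => forall M, exists n, M <= n /\ len (f n) <= L)
    (list_max (map len l))) as [L [HL Hmin]]; [eauto|].
  assert (H0 : exists N, forall n, N <= n -> L <= len (f n)).
  { destruct (excluded_middle_informative
      (exists N, forall n, N <= n -> L <= len (f n))) as [|Hn]; auto; exfalso.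
    destruct L as [|L]; [apply Hn; exists 0; intros; lia|].
    assert (S L <= L); [|lia].
    apply Hmin; intros M.
    destruct (excluded_middle_informative (exists n, M <= n /\ len (f n) <= L))
      as [|Hn']; auto; exfalso.
    apply Hn; exists M; intros n Hn1; apply not_lt; intros Hn2.
    apply Hn'; exists n; split; auto; lia. }
  destruct H0 as [N0 H0]; destruct (HL N0) as [N [HN HNL]].
  assert (HlN : len (f N) = L) by (apply Nat.le_antisymm; auto).
  assert (Hfix : is_fix (f N)).
  { destruct (excluded_middle_informative (is_fix (f N))) as [|Hn]; auto; exfalso.
    pose proof (step_len _ _ (Hs N) Hn).
    assert (L <= len (f (S N))) by (apply H0; lia); lia. }
  assert (Hle : forall n, N <= n -> len (f N) <= len (f n)).
  { intros n Hn; rewrite HlN; apply H0; lia. }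
  exists N; split; [auto|split; [auto|]].
  intros M; destruct (HL (max M N)) as [n [Hn1 Hn2]]; exists n; split; [lia|].
  apply lreach_len_eq; auto.
  - apply Clos_tidy with (f 0); auto; apply Clos_trace; auto; lia.
  - apply lreach_trace; auto; lia.
  - assert (len (f N) <= len (f n)) by (apply Hle; lia); lia.
Qed.

(** * The parity formula on the closure graph *)

(** Any level of the hierarchy makes the priorities defined; the least level enters only with the
    index. *)
Lemma tidy_chain_bound xi : tidy xi ->
  exists k, forall g m, Clos xi g -> chain_below g m -> m <= k.
Proof.
  intros Ht; destruct (AH_exists xi) as [k Hk]; exists k; intros g m.
  apply AH_tidy_bound; auto.
Qed.

(** A vertex carries a proof of membership in the closure; proof irrelevance makes it one vertex per
    formula. *)
Lemma sig_eq {A : Type} (P : A -> Prop) (u v : {x | P x}) :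
  proj1_sig u = proj1_sig v -> u = v.
Proof.
  destruct u as [u Hu], v as [v Hv]; simpl; intros ->; f_equal; apply proof_irrelevance.
Qed.

Lemma vertices_enum xi : tidy xi ->
  exists (l : list formula) (lv : list (clos_vertex xi)),
    NoDup l /\ (forall psi, In psi l <-> Clos xi psi) /\
    NoDup lv /\ (forall v, In v lv) /\ length lv = length l.
Proof.
  intros Ht; destruct (Clos_finite xi Ht) as [l0 H0].
  set (l := nodup formula_eq_dec (filter (fun f =>
    if excluded_middle_informative (Clos xi f) then true else false) l0)).
  assert (Hl : forall psi, In psi l <-> Clos xi psi).
  { intros psi; unfold l; rewrite nodup_In, filter_In.
    destruct (excluded_middle_informative (Clos xi psi)) as [H|H];
      [split; auto|split; [intros [_ E]; discriminate|tauto]]. }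
  assert (Hlv : exists lv : list (clos_vertex xi), map (@proj1_sig _ _) lv = l).
  { assert (Hi : forall psi, In psi l -> Clos xi psi) by apply Hl.
    clear Hl; induction l as [|f l' IH]; [exists []; auto|].
    destruct IH as [lv Hlv]; [intros; apply Hi; right; auto|].
    exists (exist _ f (Hi f (or_introl eq_refl)) :: lv); simpl; f_equal; exact Hlv. }
  destruct Hlv as [lv Hlv]; exists l, lv.
  assert (Hn : NoDup l) by apply NoDup_nodup.
  split; [auto|split; [auto|split; [|split]]].
  - apply (NoDup_map_inv (@proj1_sig _ _)); rewrite Hlv; auto.
  - intros v; assert (Hv : In (proj1_sig v) l) by (apply Hl, (proj2_sig v)).
    rewrite <- Hlv in Hv; apply in_map_iff in Hv as [u [Hu Hv]].
    apply sig_eq in Hu; subst; auto.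
  - rewrite <- Hlv, length_map; auto.
Qed.

Lemma last_cons {A : Type} (u v : A) p : last (u :: p) v = last p u.
Proof.
  revert u v; induction p as [|w p IH]; intros u v; [auto|].
  rewrite (IH w u); apply (IH w v).
Qed.

Lemma last_in {A : Type} (v : A) p : p <> [] -> In (last p v) p.
Proof.
  destruct p as [|u p]; [congruence|intros _; rewrite last_cons].
  revert u; induction p as [|w p IH]; intros u; [left; auto|].
  rewrite last_cons; right; apply IH.
Qed.

(** Each step off a non-fixpoint shortens, so a cycle without fixpoints would be shorter than
    itself. *)
Lemma epath_len xi p : forall v : clos_vertex xi,
  epath (pE (G_of xi)) v p -> ~ is_fix (proj1_sig v) ->
  (forall u, In u p -> ~ is_fix (proj1_sig u)) ->
  len (proj1_sig (last p v)) + length p <= len (proj1_sig v).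
Proof.
  induction p as [|u p IH]; intros v Hp Hv Hu; [simpl; lia|].
  destruct Hp as [Hs Hp]; rewrite last_cons.
  apply step_len in Hs; auto.
  specialize (IH u Hp (Hu u (or_introl eq_refl))
    (fun w Hw => Hu w (or_intror Hw))).
  simpl in *; lia.
Qed.

Lemma G_of_parity_formula xi : tidy xi -> is_parity_formula (G_of xi).
Proof.
  intros Ht; split; [|split].
  - destruct (vertices_enum xi Ht) as [_ [lv [_ [_ [_ [H _]]]]]]; eauto.
  - intros [f Hf]; simpl.
    assert (Hone : forall g, step f g -> (forall h, step f h -> h = g) ->
      exists u : clos_vertex xi, step f (proj1_sig u) /\
        forall w : clos_vertex xi, step f (proj1_sig w) -> w = u).
    { intros g Hg Hu; exists (exist _ g (Clos_step _ _ _ Hf Hg)); simpl; split; auto.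
      intros w Hw; apply sig_eq; simpl; auto. }
    destruct f; simpl; auto; try (split; auto; intros u Hu; inversion Hu; fail);
      (eapply Hone; [constructor|]; intros h Hh; inversion Hh; auto).
  - intros v p Hp He Hl.
    destruct (excluded_middle_informative
      (exists u, In u p /\ pOm (G_of xi) u <> None)) as [|Hn]; auto; exfalso.
    destruct (tidy_chain_bound xi Ht) as [k Hk].
    assert (Hf : forall u, In u p -> ~ is_fix (proj1_sig u)).
    { intros u Hu Hfix; apply Hn; exists u; split; auto.
      assert (exists e, fix_type (proj1_sig u) = Some e) as [e Hty]
        by (destruct (proj1_sig u); simpl in *; try contradiction; eauto).
      destruct (Omega_spec xi k Ht Hk (proj1_sig u) e (proj2_sig u) Hty)
        as [c [h [_ [_ [_ [_ H]]]]]].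
      simpl; rewrite H; discriminate. }
    assert (Hv : ~ is_fix (proj1_sig v)).
    { apply Hf; rewrite <- Hl; apply last_in; auto. }
    pose proof (epath_len xi p v He Hv Hf) as H.
    rewrite Hl in H; destruct p; [congruence|simpl in H; lia].
Qed.

Lemma same_cluster_equivC xi (u v : clos_vertex xi) :
  same_cluster (G_of xi) u v -> equivC (proj1_sig u) (proj1_sig v).
Proof.
  assert (H : forall a b, clos_refl_trans _ (pE (G_of xi)) a b ->
    Clos (proj1_sig a) (proj1_sig b)).
  { intros a b Hab; induction Hab; [apply rt_step; auto|apply rt_refl|].
    eapply rt_trans; eauto. }
  intros [H1 H2]; split; auto.
Qed.

Lemma alt_prio_length G hi (vs : list (pV G)) : forall v a,
  alt_prio G (v :: vs) -> pOm G v = Some a ->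
  (forall u p, In u (v :: vs) -> pOm G u = Some p -> p < hi) ->
  length (v :: vs) + a <= hi.
Proof.
  induction vs as [|w vs IH]; intros v a [_ Hvs] Ha Hhi.
  - simpl; apply (Hhi v); simpl; auto.
  - destruct Hvs as [[a' [b [Ha' [Hb [Hab _]]]]] Hvs].
    assert (a' = a) by congruence; subst a'.
    specialize (IH w b Hvs Hb (fun u p Hu => Hhi u p (or_intror Hu))).
    simpl in *; lia.
Qed.

Lemma Omega_g_fix f p : Omega_g f = Some p -> exists e, fix_type f = Some e.
Proof. destruct f; simpl; try discriminate; eauto. Qed.

Lemma fix_type_is_fix f e : fix_type f = Some e -> is_fix f.
Proof. destruct f; simpl; try discriminate; auto. Qed.

Lemma ind_le_chain_bound xi k : tidy xi ->
  (forall g m, Clos xi g -> chain_below g m -> m <= k) ->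
  exists i, ind (G_of xi) = Some i /\ i <= k.
Proof.
  intros Ht Hk.
  assert (Hb : forall n, (exists v vs, length vs = n /\ alt_prio (G_of xi) vs /\
    forall u, In u vs -> same_cluster (G_of xi) v u) -> n <= k).
  { intros n [v [vs [<- [Ha Hs]]]]; destruct vs as [|w vs]; [simpl; lia|].
    assert (exists a, Omega_g (proj1_sig w) = Some a) as [a Hw].
    { destruct Ha as [Ha _]; simpl in Ha.
      destruct (Omega_g (proj1_sig w)); [eauto|congruence]. }
    destruct (Omega_g_fix _ _ Hw) as [e He]; apply fix_type_is_fix in He.
    destruct (Omega_range xi k Ht Hk (proj1_sig w) (proj2_sig w) He)
      as [lo [c [Hc Hr]]].
    assert (Hin : forall u p, In u (w :: vs) -> Omega_g (proj1_sig u) = Some p ->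
      lo <= p < lo + c).
    { intros u p Hu Hp; apply (Hr (proj1_sig u)); auto.
      - destruct (Omega_g_fix _ _ Hp) as [e' He']; apply fix_type_is_fix in He'; auto.
      - apply same_cluster_equivC.
        destruct (Hs w (or_introl eq_refl)) as [H1 H2], (Hs u Hu) as [H3 H4].
        split; eapply rt_trans; eauto. }
    pose proof (alt_prio_length (G_of xi) (lo + c) vs w a Ha Hw
      (fun u p Hu Hp => proj2 (Hin u p Hu Hp))) as Hlen.
    destruct (Hin w a (or_introl eq_refl) Hw); lia. }
  edestruct bounded_maxP as [i Hi]; [|exact Hb|].
  - exists (pvI (G_of xi)), []; simpl; split; [reflexivity|split; [auto|intros u []]].
  - exists i; split; [apply max_opt_intro; auto|apply Hb, Hi].
Qed.

Lemma ind_le_ad xi : tidy xi ->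
  exists i a, ind (G_of xi) = Some i /\ ad xi = Some a /\ i <= a.
Proof.
  intros Ht; destruct (AH_exists xi) as [k Hk].
  destruct (least (fun n => AH FMu n xi /\ AH FNu n xi) k) as [a Ha]; [auto|].
  destruct (ind_le_chain_bound xi a Ht) as [i [Hi Hia]].
  { intros g m; apply AH_tidy_bound; auto; apply Ha. }
  exists i, a; split; [auto|split; [apply min_opt_intro; auto|auto]].
Qed.

Lemma gmove_step M xi (p q : pos M (G_of xi)) : gmove M (G_of xi) p q ->
  step (proj1_sig (fst p)) (proj1_sig (fst q)).
Proof.
  unfold gmove; intros H; destruct (pL (G_of xi) (fst p)); try contradiction; apply H.
Qed.

(** From [N] on every fixpoint lies below [f N] in the closure order, so by [Omega_mono] none has a
    larger priority, while the priority of [f N] recurs. *)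
Lemma parity_win_trace M xi (pi : nat -> pos M (G_of xi)) N e : tidy xi ->
  (forall n, gmove M (G_of xi) (pi n) (pi (S n))) ->
  let f := fun n => proj1_sig (fst (pi n)) in
  fix_type (f N) = Some e -> (forall n, N <= n -> len (f N) <= len (f n)) ->
  (forall K, exists n, K <= n /\ f n = f N) ->
  (parity_win M (G_of xi) pi <-> e = FNu).
Proof.
  intros Ht Hm f He Hlen Hinf.
  destruct (tidy_chain_bound xi Ht) as [k Hk].
  assert (Hs : forall n, step (f n) (f (S n))) by (intros n; apply gmove_step; auto).
  assert (Hcl : forall n, Clos xi (f n)) by (intros n; apply (proj2_sig (fst (pi n)))).
  destruct (Omega_spec xi k Ht Hk (f N) e (Hcl N) He) as [c [h [_ [_ [_ [_ Hp]]]]]].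
  set (p := if Bool.eqb _ _ then _ else _) in Hp.
  pose proof (Omega_parity xi k Ht Hk _ _ _ (Hcl N) He Hp) as Hodd.
  assert (Hmax : forall n q, N <= n -> Omega_g (f n) = Some q -> q <= p).
  { intros n q Hn Hq; destruct (Omega_g_fix _ _ Hq) as [e' He'].
    eapply (Omega_mono xi k Ht Hk (f n) (f N)); eauto.
    split; [eapply fix_type_is_fix; eauto|split; [eapply fix_type_is_fix; eauto|]].
    apply lreach_trace; auto. }
  assert (Hoften : forall K, exists n, K <= n /\ Omega_g (f n) = Some p).
  { intros K; destruct (Hinf K) as [n [Hn E]]; exists n; split; auto; congruence. }
  assert (Heven : Nat.even p = true <-> e = FNu).
  { rewrite <- Nat.negb_odd, Hodd; destruct e; simpl; split; congruence. }
  rewrite <- Heven; split.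
  - intros [q [Hq [H1 [N' H2]]]].
    assert (q = p); [|congruence].
    apply Nat.le_antisymm.
    + destruct (H1 N) as [n [Hn E]]; eapply Hmax; eauto.
    + destruct (Hoften N') as [n [Hn E]]; eapply H2; eauto.
  - intros Hev; exists p; split; [auto|split; [exact Hoften|]].
    exists N; intros n m Hn E; eapply Hmax; eauto.
Qed.

(** * Ordinal approximations of fixpoints *)

(** Ordinals as well-founded trees: descent goes to an immediate subtree, and branching over
    arbitrary types allows suprema indexed by the states of a model. *)
Inductive ord : Type := OSup (A : Type) (f : A -> ord).

Definition ochild (b a : ord) : Prop :=
  match a with OSup A f => exists x, b = f x end.

Lemma ochild_wf : well_founded ochild.
Proof.
  intros a; induction a as [A f IH]; constructor; intros b [x ->]; auto.
Qed.

Lemma fop_eq_dec (e f : fop) : {e = f} + {e <> f}.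
Proof. decide equality. Qed.

Section Fixpoints.
Context {S : Type}.
Implicit Types (U V : S -> Prop) (F : (S -> Prop) -> S -> Prop).

Definition monotone F : Prop :=
  forall U V, (forall s, U s -> V s) -> forall s, F U s -> F V s.

Definition fixp (e : fop) F (s : S) : Prop :=
  match e with
  | FMu => forall U, (forall t, F U t -> U t) -> U s
  | FNu => exists U, (forall t, U t -> F U t) /\ U s
  end.

(** A node stands for the supremum of the successors of its children, so a leaf yields the empty set
    for [FMu] and the full set for [FNu]. *)
Fixpoint approx (e : fop) F (o : ord) (s : S) : Prop :=
  match o with
  | OSup A f =>
      match e with
      | FMu => exists a, F (approx e F (f a)) s
      | FNu => forall a, F (approx e F (f a)) s
      end
  end.

Lemma fixp_unfold e F : monotone F -> forall s, fixp e F s <-> F (fixp e F) s.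
Proof.
  intros HF; destruct e.
  - assert (H : forall s, F (fixp FMu F) s -> fixp FMu F s).
    { intros s Hs U HU; apply HU; revert s Hs; apply HF; intros s Hs; apply Hs; auto. }
    intros s; split; auto; intros Hs; apply Hs; apply HF; auto.
  - assert (H : forall s, fixp FNu F s -> F (fixp FNu F) s).
    { intros s [U [HU Hs]]; apply HU in Hs; revert s Hs; apply HF.
      intros s Hs; exists U; auto. }
    intros s; split; auto; intros Hs; exists (F (fixp FNu F)); split; auto.
    apply HF; auto.
Qed.

Lemma fixp_mono e F G : (forall U s, F U s -> G U s) ->
  forall s, fixp e F s -> fixp e G s.
Proof.
  intros H s; destruct e; simpl.
  - intros Hs U HU; apply Hs; auto.
  - intros [U [HU Hs]]; exists U; auto.
Qed.

Lemma approx_mono e F G : monotone F -> (forall U s, F U s -> G U s) ->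
  forall o s, approx e F o s -> approx e G o s.
Proof.
  intros HF H o; induction o as [A f IH]; intros s; destruct e; simpl.
  - intros [a Ha]; exists a; apply H; revert s Ha; apply HF; auto.
  - intros Hs a; apply H; specialize (Hs a); revert s Hs; apply HF; auto.
Qed.

(** The union of all stages is closed under [F]: it is contained in a single stage, the supremum
    over all states of one chosen stage per state. *)
Lemma lfp_approx F : monotone F -> forall s, fixp FMu F s ->
  exists o, approx FMu F o s.
Proof.
  intros HF s Hs; apply Hs; clear s Hs; intros s Hs.
  assert (Hpost : forall o s, approx FMu F o s -> F (approx FMu F o) s).
  { induction o as [A f IH]; intros t [a Ha]; revert t Ha; apply HF.
    intros t Ht; exists a; auto. }
  (* A state in no stage gets an arbitrary tree. *)
  assert (Hch : forall t, exists o, (exists o', approx FMu F o' t) -> approx FMu F o t).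
  { intros t; destruct (excluded_middle_informative (exists o', approx FMu F o' t))
      as [[o Ho]|Hn]; [eauto|exists (OSup S (fun _ => OSup False (fun x => match x with end)))].
    tauto. }
  set (g := fun t => proj1_sig (constructive_indefinite_description _ (Hch t))).
  (* The inner node is the supremum over all states; the unary outer node accounts for the
     additional application of [F]. *)
  exists (OSup unit (fun _ => OSup S g)), tt; revert s Hs; apply HF.
  intros t Ht; exists t; apply Hpost.
  apply (proj2_sig (constructive_indefinite_description _ (Hch t))); auto.
Qed.

(** Dual to [lfp_approx]: each state gets a stage that excludes it if any stage does, and a state
    surviving all of these survives every stage. *)
Lemma gfp_approx F : monotone F -> forall s, (forall o, approx FNu F o s) ->
  fixp FNu F s.
Proof.
  intros HF s Hs; exists (fun t => forall o, approx FNu F o t); split; auto.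
  clear s Hs; intros s Hs.
  assert (Hpre : forall o s, F (approx FNu F o) s -> approx FNu F o s).
  { induction o as [A f IH]; intros t Ht a; revert t Ht; apply HF.
    intros t Ht; auto. }
  assert (Hch : forall t, exists o, approx FNu F o t -> forall o', approx FNu F o' t).
  { intros t; destruct (excluded_middle_informative (forall o', approx FNu F o' t))
      as [H|Hn]; [exists (OSup S (fun _ => OSup False (fun x => match x with end))); auto|].
    apply not_all_ex_not in Hn as [o Ho]; exists o; tauto. }
  set (g := fun t => proj1_sig (constructive_indefinite_description _ (Hch t))).
  specialize (Hs (OSup unit (fun _ => OSup S g)) tt).
  revert s Hs; apply HF; intros t Ht.
  apply (proj2_sig (constructive_indefinite_description _ (Hch t))).
  apply Hpre, Ht.
Qed.
End Fixpoints.

(** * Annotated formulas *)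

(** [None] marks the fixpoint itself, [Some b] its approximant at [b]. *)
Inductive afm : Type :=
| ATop | ABot | AProp (p : nat) | ANProp (p : nat) | AVar (x : nat)
| AAnd (a b : afm) | AOr (a b : afm) | ADia (a : afm) | ABox (a : afm)
| AFix (e : fop) (o : option ord) (x : nat) (a : afm).

Fixpoint erase (a : afm) : formula :=
  match a with
  | ATop => FTop | ABot => FBot | AProp p => FProp p | ANProp p => FNProp p
  | AVar x => FVar x
  | AAnd a b => FAnd (erase a) (erase b)
  | AOr a b => FOr (erase a) (erase b)
  | ADia a => FDia (erase a)
  | ABox a => FBox (erase a)
  | AFix e _ x a => FFix e x (erase a)
  end.

Fixpoint embed (f : formula) : afm :=
  match f with
  | FTop => ATop | FBot => ABot | FProp p => AProp p | FNProp p => ANProp p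
  | FVar x => AVar x
  | FAnd a b => AAnd (embed a) (embed b)
  | FOr a b => AOr (embed a) (embed b)
  | FDia a => ADia (embed a)
  | FBox a => ABox (embed a)
  | FFix e x a => AFix e None x (embed a)
  end.

Fixpoint asubst (c : afm) (x : nat) (s : afm) : afm :=
  match c with
  | AVar y => if Nat.eqb y x then s else AVar y
  | AAnd a b => AAnd (asubst a x s) (asubst b x s)
  | AOr a b => AOr (asubst a x s) (asubst b x s)
  | ADia a => ADia (asubst a x s)
  | ABox a => ABox (asubst a x s)
  | AFix e o y a => if Nat.eqb y x then AFix e o y a else AFix e o y (asubst a x s)
  | f => f
  end.

Lemma erase_embed f : erase (embed f) = f.
Proof. induction f; simpl; congruence. Qed.

Lemma erase_asubst c x s : erase (asubst c x s) = subst (erase c) x (erase s).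
Proof.
  induction c; simpl; try congruence.
  - destruct (Nat.eqb_spec x0 x); auto.
  - destruct (Nat.eqb_spec x0 x); simpl; congruence.
Qed.

Lemma asubst_notin c x s : ~ In x (fv (erase c)) -> asubst c x s = c.
Proof.
  induction c; intros H; simpl in *; auto;
    try (rewrite in_app_iff in H; rewrite IHc1, IHc2 by tauto; reflexivity);
    try (rewrite IHc by tauto; reflexivity).
  - destruct (Nat.eqb_spec x0 x); tauto.
  - destruct (Nat.eqb_spec x0 x) as [|Hn]; auto.
    rewrite IHc; auto. intros Hc; apply H, filter_In.
    rewrite negb_true_iff, Nat.eqb_neq; auto.
Qed.

(* [pol] is the fixpoint type that is bad for the player under consideration:
   only these fixpoints are approximated, and unfolding one of them has to
   decrease its annotation. *)
Inductive astep (pol : fop) : afm -> afm -> Prop :=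
| as_andl a b : astep pol (AAnd a b) a
| as_andr a b : astep pol (AAnd a b) b
| as_orl a b : astep pol (AOr a b) a
| as_orr a b : astep pol (AOr a b) b
| as_dia a : astep pol (ADia a) a
| as_box a : astep pol (ABox a) a
| as_fix e o o' x c :
    (e = pol -> exists b, o' = Some b /\ forall a, o = Some a -> ochild b a) ->
    astep pol (AFix e o x c) (asubst c x (AFix e o' x c)).

Lemma astep_erase pol a b : astep pol a b -> step (erase a) (erase b).
Proof.
  destruct 1; simpl; try constructor.
  rewrite erase_asubst; simpl; constructor.
Qed.

(* [fills y X r a]: [a] is an annotation of [r] with [X] put for [y]. *)
Inductive fills (y : nat) (X : afm) : formula -> afm -> Prop :=
| fi_hole : fills y X (FVar y) X
| fi_top : fills y X FTop ATop
| fi_bot : fills y X FBot ABot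
| fi_prop p : fills y X (FProp p) (AProp p)
| fi_nprop p : fills y X (FNProp p) (ANProp p)
| fi_var x : x <> y -> fills y X (FVar x) (AVar x)
| fi_and f g a b : fills y X f a -> fills y X g b -> fills y X (FAnd f g) (AAnd a b)
| fi_or f g a b : fills y X f a -> fills y X g b -> fills y X (FOr f g) (AOr a b)
| fi_dia f a : fills y X f a -> fills y X (FDia f) (ADia a)
| fi_box f a : fills y X f a -> fills y X (FBox f) (ABox a)
| fi_fix e o x f a : x <> y -> fills y X f a -> fills y X (FFix e x f) (AFix e o x a).

Lemma fills_erase y X r a : fills y X r a -> erase a = subst r y (erase X).
Proof.
  induction 1; simpl; try congruence.
  - rewrite Nat.eqb_refl; auto.
  - destruct (Nat.eqb_spec x y); congruence.
  - destruct (Nat.eqb_spec x y); congruence.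
Qed.

Lemma fills_self y X c : ~ In y (fv (erase c)) -> ~ In y (bv (erase c)) ->
  fills y X (erase c) c.
Proof.
  induction c; simpl; intros Hf Hb; rewrite ?in_app_iff in *;
    try (constructor; solve [auto | apply IHc1; tauto | apply IHc2; tauto]).
  apply fi_fix; [tauto|].
  apply IHc; [|tauto]; intros H; apply Hf, filter_In.
  rewrite negb_true_iff, Nat.eqb_neq; split; auto; intros ->; tauto.
Qed.

Lemma fills_subst y X z d c r b : z <> y -> ~ In z (fv (erase X)) ->
  fills y X d c -> fills y X r b -> fills y X (subst d z r) (asubst c z b).
Proof.
  intros Hzy Hz Hd Hr; induction Hd; simpl; try constructor; auto.
  - destruct (Nat.eqb_spec y z); [congruence|].
    rewrite asubst_notin by auto; constructor.
  - destruct (Nat.eqb_spec x z); auto; constructor; auto.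
  - destruct (Nat.eqb_spec x z); constructor; auto.
Qed.

(** Until the trace stands at the hole, the copies of [X] are only moved around, with their
    annotation unchanged. *)
Lemma fills_step pol y X r a b : bv_avoids y (erase X) r -> r <> FVar y ->
  fills y X r a -> astep pol a b -> exists r', step r r' /\ fills y X r' b.
Proof.
  intros Ha Hr Hf Hs.
  destruct Hf; try congruence; try (inversion Hs; subst; eauto using step; fail).
  inversion Hs; subst; eexists; split; [constructor|].
  apply fills_subst; auto.
  - apply (Ha x); simpl; auto.
  - apply fi_fix; auto.
Qed.

Lemma astep_trace pol (a : nat -> afm) : (forall n, astep pol (a n) (a (S n))) ->
  forall n, step (erase (a n)) (erase (a (S n))).
Proof. intros H n; apply (astep_erase pol); auto. Qed.

(** The first step plants copies [X] of the fixpoint with a smaller ordinal [b]. Up to the first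
    return to the initial length, every formula is a residual filled with [X]; at the return the
    residual is the hole, so the formula is [X] itself. *)
Lemma astep_return pol (a : nat -> afm) o x c : a 0 = AFix pol o x c ->
  tidy (erase (a 0)) -> (forall n, astep pol (a n) (a (S n))) ->
  (forall n, len (erase (a 0)) <= len (erase (a n))) ->
  (exists n, 0 < n /\ len (erase (a n)) = len (erase (a 0))) ->
  exists b n, a n = AFix pol (Some b) x c /\ forall d, o = Some d -> ochild b d.
Proof.
  intros H0 Ht Hs Hlen Hret.
  destruct Hret as [n0 Hn0].
  destruct (least (fun n => 0 < n /\ len (erase (a n)) = len (erase (a 0))) n0 Hn0)
    as [n [[Hn Hna] Hmin]]; clear n0 Hn0.
  assert (exists b, (forall d, o = Some d -> ochild b d) /\
    a 1 = asubst c x (AFix pol (Some b) x c)) as [b [Hb H1]].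
  { pose proof (Hs 0) as H; rewrite H0 in H; inversion H as [| | | | | |e o1 o' x1 c1 Ho]; subst.
    destruct (Ho eq_refl) as [b [-> Hb]]; exists b; auto. }
  rewrite H0 in Ht, Hlen, Hna; simpl in Ht, Hlen, Hna.
  set (X := AFix pol (Some b) x c) in *.
  destruct (fresh_var (x :: fv (erase c) ++ bv (erase c))) as [y Hy].
  assert (Hy' := Hy); simpl in Hy'; rewrite in_app_iff in Hy'.
  assert (Hinv : forall m, 1 <= m <= n ->
    exists r, residual pol x (erase c) y r /\ fills y X r (a m)).
  { intros m [Hm Hmn]; induction Hm as [|m Hm IH].
    - assert (Hf : fills y X (subst (erase c) x (FVar y)) (a 1)).
      { rewrite H1; apply fills_subst; [intros ->; tauto| |apply fills_self; tauto|constructor].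
        intros H; simpl in H; apply filter_In in H as [_ H].
        rewrite Nat.eqb_refl in H; discriminate. }
      exists (subst (erase c) x (FVar y)); split; auto.
      destruct (residual_unfold pol x (erase c) y Hy) as [H|H]; auto; exfalso.
      pose proof (Hlen 1) as H2; rewrite H1, erase_asubst in H2.
      simpl erase in H2; rewrite H in H2; lia.
    - destruct IH as [r [Hr Hf]]; [lia|].
      (* Standing at the hole before time [n] would be an earlier return. *)
      assert (Hry : r <> FVar y).
      { intros ->; assert (n <= m); [|lia]; apply Hmin; split; [lia|].
        rewrite (fills_erase _ _ _ _ Hf); simpl; rewrite Nat.eqb_refl, H0; auto. }
      pose proof (residual_avoids pol x (erase c) y Ht Hy r Hr) as Ha.
      destruct (fills_step pol y X r _ _ Ha Hry Hf (Hs m)) as [r' [Hrr Hf']].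
      exists r'; split; auto.
      destruct (residual_step pol x (erase c) y Ht Hy r r' Hr Hrr) as [H|[H H2]]; auto.
      exfalso; apply subf_len in H2; pose proof (Hlen (S m)) as H3.
      rewrite (fills_erase _ _ _ _ Hf') in H3; simpl erase in H3.
      rewrite H in H3; lia. }
  exists b, n; split; auto.
  destruct (Hinv n) as [r [Hr Hf]]; [lia|].
  assert (r = FVar y).
  { apply len_subst_eq with (s := erase X); [apply Hr|].
    rewrite <- (fills_erase _ _ _ _ Hf), Hna; auto. }
  subst r; inversion Hf; subst; auto; congruence.
Qed.

(** The first return supplies an ordinal even if there was none at [N]; each further return passes
    to a child of it, against well-foundedness. *)
Lemma no_bad_trace pol (a : nat -> afm) N :
  tidy (erase (a 0)) -> (forall n, astep pol (a n) (a (S n))) ->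
  fix_type (erase (a N)) = Some pol ->
  (forall n, N <= n -> len (erase (a N)) <= len (erase (a n))) ->
  (forall K, exists n, K <= n /\ erase (a n) = erase (a N)) -> False.
Proof.
  intros Ht Hs Hty Hlen Hinf.
  assert (Hnext : forall N o x c, a N = AFix pol o x c ->
    (forall n, N <= n -> len (erase (a N)) <= len (erase (a n))) ->
    (forall K, exists n, K <= n /\ len (erase (a n)) = len (erase (a N))) ->
    exists b n, N <= n /\ a n = AFix pol (Some b) x c /\
      forall d, o = Some d -> ochild b d).
  { clear N Hty Hlen Hinf; intros N o x c HN Hlen Hinf.
    destruct (astep_return pol (fun n => a (N + n)) o x c)
      as [b' [n [Hn Hb]]]; rewrite ?Nat.add_0_r; auto.
    - apply Clos_tidy with (erase (a 0)); auto.
      apply (Clos_trace (fun n => erase (a n)) 0 N); [|lia].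
      apply (astep_trace pol a Hs).
    - intros n; rewrite <- plus_n_Sm; auto.
    - intros n; apply Hlen; lia.
    - destruct (Hinf (S N)) as [n [Hn1 Hn2]]; exists (n - N); split; [lia|].
      replace (N + (n - N)) with n by lia; auto.
    - exists b', (N + n); split; [lia|auto]. }
  assert (Hgen : forall (b : ord) x c N, a N = AFix pol (Some b) x c ->
    (forall n, N <= n -> len (erase (a N)) <= len (erase (a n))) ->
    (forall K, exists n, K <= n /\ len (erase (a n)) = len (erase (a N))) ->
    False).
  { clear N Hty Hlen Hinf.
    intros b; induction b as [b IH] using (well_founded_ind ochild_wf).
    intros x c N HN Hlen Hinf.
    destruct (Hnext N (Some b) x c HN Hlen Hinf) as [b' [n [Hn [Ha Hb]]]].
    assert (E : len (erase (a n)) = len (erase (a N))) by (rewrite HN, Ha; auto).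
    apply (IH b' (Hb b eq_refl) x c n); auto; rewrite E; auto.
    intros m Hm; apply Hlen; lia. }
  assert (exists o x c, a N = AFix pol o x c) as [o [x [c HN]]].
  { destruct (a N); simpl in Hty; try discriminate; injection Hty as ->; eauto. }
  assert (Hinf' : forall K, exists n, K <= n /\ len (erase (a n)) = len (erase (a N))).
  { intros K; destruct (Hinf K) as [n [Hn E]]; exists n; rewrite E; auto. }
  destruct (Hnext N o x c HN Hlen Hinf') as [b [n [Hn [Ha _]]]].
  assert (E : len (erase (a n)) = len (erase (a N))) by (rewrite HN, Ha; auto).
  apply (Hgen b x c n); auto; rewrite E; auto.
  intros m Hm; apply Hlen; lia.
Qed.

(** * Meaning of annotated formulas and its preservation by moves *)

Section Semantics.
Variables (pol : fop) (M : kripke).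

(** An annotation is read only on fixpoints of type [pol]; the others denote their actual
    fixpoint. *)
Fixpoint asem (rho : nat -> St M -> Prop) (a : afm) : St M -> Prop :=
  match a with
  | ATop => fun _ => True
  | ABot => fun _ => False
  | AProp p => ValP M p
  | ANProp p => fun s => ~ ValP M p s
  | AVar x => rho x
  | AAnd a b => fun s => asem rho a s /\ asem rho b s
  | AOr a b => fun s => asem rho a s \/ asem rho b s
  | ADia a => fun s => exists t, Rel M s t /\ asem rho a t
  | ABox a => fun s => forall t, Rel M s t -> asem rho a t
  | AFix e o x a =>
      let F := fun U => asem (upd rho x U) a in
      match o with
      | Some b => if fop_eq_dec e pol then approx e F b else fixp e F
      | None => fixp e F
      end
  end.

Lemma asem_embed f : forall rho s, asem rho (embed f) s <-> sem M rho f s.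
Proof.
  induction f as [| |p|p|x|a IHa b IHb|a IHa b IHb|a IHa|a IHa|e x a IHa];
    intros rho s; simpl; try tauto.
  - rewrite IHa, IHb; tauto.
  - rewrite IHa, IHb; tauto.
  - split; intros [t [H1 H2]]; exists t; split; auto; apply IHa; auto.
  - split; intros H t Ht; apply IHa; auto.
  - destruct e; simpl; split.
    + intros H U HU; apply H; intros t Ht; apply HU, IHa; auto.
    + intros H U HU; apply H; intros t Ht; apply HU, IHa; auto.
    + intros [U [HU Hs]]; exists U; split; auto; intros t Ht; apply IHa; auto.
    + intros [U [HU Hs]]; exists U; split; auto; intros t Ht; apply IHa; auto.
Qed.

Lemma asem_mono a : forall rho rho' : nat -> St M -> Prop,
  (forall v, In v (fv (erase a)) -> forall s, rho v s -> rho' v s) ->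
  forall s, asem rho a s -> asem rho' a s.
Proof.
  induction a as [| |p|p|x|a IHa b IHb|a IHa b IHb|a IHa|a IHa|e o x a IHa];
    intros rho rho' H s; simpl in H |- *; auto.
  - intros [H1 H2]; split; [apply (IHa rho)|apply (IHb rho)]; auto;
      intros v Hv; apply H, in_or_app; auto.
  - intros [H1|H2]; [left; apply (IHa rho)|right; apply (IHb rho)]; auto;
      intros v Hv; apply H, in_or_app; auto.
  - intros [t [H1 H2]]; exists t; split; eauto.
  - intros H1 t Ht; eauto.
  - assert (Hupd : forall (U V : St M -> Prop), (forall s, U s -> V s) ->
      forall v, In v (fv (erase a)) -> forall s, upd rho x U v s -> upd rho' x V v s).
    { intros U V HUV v Hv t; unfold upd; destruct (Nat.eqb_spec v x); auto.
      apply H, filter_In; rewrite negb_true_iff, Nat.eqb_neq; auto. }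
    assert (Hmono : monotone (fun U => asem (upd rho x U) a)).
    { intros U V HUV; apply IHa; intros v Hv t; unfold upd.
      destruct (Nat.eqb_spec v x); auto. }
    assert (Hle : forall U s, asem (upd rho x U) a s -> asem (upd rho' x U) a s)
      by (intros U; apply IHa, Hupd; auto).
    destruct o as [b|]; [destruct (fop_eq_dec e pol)|];
      [apply approx_mono|apply fixp_mono|apply fixp_mono]; auto.
Qed.

Lemma asem_ext a rho rho' :
  (forall v, In v (fv (erase a)) -> forall s, rho v s <-> rho' v s) ->
  forall s, asem rho a s <-> asem rho' a s.
Proof. intros H s; split; apply asem_mono; intros v Hv t; apply H; auto. Qed.

Lemma asem_body_mono rho x a : monotone (fun U => asem (upd rho x U) a).
Proof.
  intros U V HUV; apply asem_mono; intros v _ t; unfold upd.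
  destruct (Nat.eqb v x); auto.
Qed.

Lemma asem_asubst a x b : forall rho,
  (forall v, In v (fv (erase b)) -> ~ In v (bv (erase a))) ->
  forall s, asem rho (asubst a x b) s <-> asem (upd rho x (asem rho b)) a s.
Proof.
  induction a as [| |p|p|z|a1 IH1 a2 IH2|a1 IH1 a2 IH2|a IHa|a IHa|e o z a IHa];
    intros rho H s; simpl in H |- *; try tauto.
  - unfold upd; destruct (Nat.eqb_spec z x); simpl; tauto.
  - rewrite IH1, IH2; [tauto| |]; intros v Hv Hb; apply (H v Hv), in_or_app; auto.
  - rewrite IH1, IH2; [tauto| |]; intros v Hv Hb; apply (H v Hv), in_or_app; auto.
  - split; intros [t [H1 H2]]; exists t; split; auto; apply IHa; auto.
  - split; intros H1 t Ht; apply IHa; auto.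
  - destruct (Nat.eqb_spec z x) as [->|Hn].
    + apply (asem_ext (AFix e o x a)).
      intros v Hv t; simpl erase in Hv; apply in_fv_fix in Hv; unfold upd.
      destruct (Nat.eqb_spec v x); tauto.
    (* The updates at [x] and [z] commute, because the bound [z] is not free in [b] and so does not
       affect its meaning. *)
    + assert (E : forall U s, asem (upd rho z U) (asubst a x b) s <->
        asem (upd (upd rho x (asem rho b)) z U) a s).
      { intros U t; rewrite IHa by (intros v Hv Hb; apply (H v Hv); auto).
        apply asem_ext; intros v Hv t'; unfold upd at 1 3.
        destruct (Nat.eqb_spec v x) as [->|].
        - unfold upd; destruct (Nat.eqb_spec x z); [congruence|].
          rewrite Nat.eqb_refl; apply asem_ext; intros w Hw t''.
          destruct (Nat.eqb_spec w z) as [->|]; [|tauto].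
          exfalso; apply (H z Hw); auto.
        - unfold upd; destruct (Nat.eqb_spec v z), (Nat.eqb_spec v x); tauto. }
      assert (E1 : forall U s, asem (upd rho z U) (asubst a x b) s ->
        asem (upd (upd rho x (asem rho b)) z U) a s) by (intros; apply E; auto).
      assert (E2 : forall U s, asem (upd (upd rho x (asem rho b)) z U) a s ->
        asem (upd rho z U) (asubst a x b) s) by (intros; apply E; auto).
      simpl; destruct o as [d|]; [destruct (fop_eq_dec e pol)|];
        split; [apply approx_mono|apply approx_mono|apply fixp_mono|apply fixp_mono
               |apply fixp_mono|apply fixp_mono]; auto using asem_body_mono.
Qed.

Definition holds (rho : nat -> St M -> Prop) (a : afm) (s : St M) : Prop :=
  match pol with FMu => asem rho a s | FNu => ~ asem rho a s end.

Lemma asem_unfold rho e o x c : tidy (erase (AFix e o x c)) ->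
  forall s, asem (upd rho x (asem rho (AFix e o x c))) c s <->
            asem rho (asubst c x (AFix e o x c)) s.
Proof.
  intros Ht s; symmetry; apply asem_asubst.
  intros v Hv Hb; apply (Ht v Hv); simpl; auto.
Qed.

(** Truth of a least and falsity of a greatest fixpoint at stage [d] are witnessed by a child of
    [d], which becomes the new annotation. For the other type the fixpoint equation applies and the
    annotation stays. *)
Lemma holds_unfold rho e o x c s : tidy (erase (AFix e o x c)) ->
  holds rho (AFix e o x c) s -> exists o',
    (e = pol -> exists b, o' = Some b /\ forall a, o = Some a -> ochild b a) /\
    holds rho (asubst c x (AFix e o' x c)) s.
Proof.
  intros Ht H.
  set (F := fun U => asem (upd rho x U) c).
  assert (HF : monotone F) by apply asem_body_mono.
  destruct (fop_eq_dec e pol) as [E|E].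
  - assert (Hb : forall b t, asem rho (asubst c x (AFix e (Some b) x c)) t <->
      F (approx e F b) t).
    { intros b t; rewrite <- asem_unfold by exact Ht; simpl.
      destruct (fop_eq_dec e pol); [tauto|congruence]. }
    (* [d] is the present annotation, or for a bare fixpoint some stage at which it is already true
       (for [FMu]) or false (for [FNu]). *)
    assert (Ho : exists d, (forall a, o = Some a -> d = a) /\
      match pol with FMu => approx e F d s | FNu => ~ approx e F d s end).
    { unfold holds in H; simpl in H; fold F in H.
      destruct o as [d|].
      - exists d; split; [congruence|].
        destruct (fop_eq_dec e pol); [auto|congruence].
      - subst e; destruct pol.
        + apply lfp_approx in H as [d Hd]; auto; exists d; split; auto; congruence.
        + assert (exists d, ~ approx FNu F d s) as [d Hd].
          { apply not_all_ex_not; intros Hd; apply H, gfp_approx; auto. }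
          exists d; split; auto; congruence. }
    destruct Ho as [[A f] [Hd Ha]].
    assert (exists a, match pol with FMu => F (approx e F (f a)) s
                                   | FNu => ~ F (approx e F (f a)) s end) as [a Hfa].
    { revert Ha; rewrite E; destruct pol; simpl; auto.
      intros Ha; apply not_all_ex_not; auto. }
    exists (Some (f a)); split.
    + intros _; exists (f a); split; auto.
      intros d Hod; rewrite <- (Hd d Hod); simpl; eauto.
    + unfold holds; destruct pol; rewrite Hb; auto.
  - exists o; split; [congruence|].
    assert (Hu : asem rho (AFix e o x c) s <-> asem rho (asubst c x (AFix e o x c)) s).
    { assert (Hfix : forall t, asem rho (AFix e o x c) t <-> fixp e F t).
      { intros t; simpl; destruct o; [destruct (fop_eq_dec e pol)|]; tauto. }
      rewrite <- asem_unfold by exact Ht.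
      rewrite Hfix, (fixp_unfold e F HF); split; apply HF; intros t; apply Hfix. }
    unfold holds in *; destruct pol; tauto.
Qed.

Definition fmove (p q : formula * St M) : Prop :=
  step (fst p) (fst q) /\
  match fst p with
  | FDia _ | FBox _ => Rel M (snd p) (snd q)
  | _ => snd q = snd p
  end.

(** Positions where the annotating player must select a move that keeps the annotation; elsewhere
    every move keeps one. *)
Definition chooses (f : formula) : Prop :=
  match f with
  | FOr _ _ | FDia _ => pol = FMu
  | FAnd _ _ | FBox _ => pol = FNu
  | _ => False
  end.

Lemma holds_any_move rho a s g t : tidy (erase a) -> holds rho a s ->
  ~ chooses (erase a) -> fmove (erase a, s) (g, t) ->
  exists b, erase b = g /\ astep pol a b /\ holds rho b t.
Proof.
  intros Ht Ha Hc [Hs Hst]; simpl in Hs, Hst.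
  destruct a as [| |p|p|x|a b|a b|a|a|e o x c]; simpl in Hs, Hst; inversion Hs;
    subst; simpl in Hc.
  - exists a; split; [auto|split; [constructor|]].
    unfold holds in *; destruct pol; [apply Ha|tauto].
  - exists b; split; [auto|split; [constructor|]].
    unfold holds in *; destruct pol; [apply Ha|tauto].
  - exists a; split; [auto|split; [constructor|]].
    unfold holds in *; destruct pol; [tauto|simpl in Ha; tauto].
  - exists b; split; [auto|split; [constructor|]].
    unfold holds in *; destruct pol; [tauto|simpl in Ha; tauto].
  - exists a; split; [auto|split; [constructor|]].
    unfold holds in *; destruct pol; [tauto|simpl in Ha; eauto].
  - exists a; split; [auto|split; [constructor|]].
    unfold holds in *; destruct pol; [simpl in Ha; eauto|tauto].
  - destruct (holds_unfold rho e o x c s Ht Ha) as [o' [H1 H2]].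
    exists (asubst c x (AFix e o' x c)); split; [|split; auto].
    + rewrite erase_asubst; auto.
    + constructor; auto.
Qed.

Lemma holds_some_move rho a s : holds rho a s -> chooses (erase a) ->
  exists b t, fmove (erase a, s) (erase b, t) /\ astep pol a b /\ holds rho b t.
Proof.
  intros Ha Hc; unfold holds, fmove in *.
  destruct a as [| |p|p|x|a b|a b|a|a|e o x c]; simpl in *; try contradiction;
    rewrite Hc in *.
  - destruct (excluded_middle_informative (asem rho a s)) as [H|H].
    + exists b, s; repeat split; auto using step, astep.
    + exists a, s; repeat split; auto using step, astep.
  - destruct Ha as [H|H]; [exists a, s|exists b, s]; repeat split; auto using step, astep.
  - destruct Ha as [t [H1 H2]]; exists a, t; repeat split; auto using step, astep.
  - apply not_all_ex_not in Ha as [t Ha]; apply imply_to_and in Ha as [H1 H2].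
    exists a, t; repeat split; auto using step, astep.
Qed.

End Semantics.

(** * Adequacy *)

Lemma dependent_choice {A : Type} (P : A -> Prop) (R : A -> A -> Prop) x :
  P x -> (forall y, P y -> exists z, P z /\ R y z) ->
  exists f : nat -> A, f 0 = x /\ forall n, P (f n) /\ R (f n) (f (S n)).
Proof.
  intros Hx H.
  set (g := fun y => epsilon (inhabits x) (fun z => P z /\ R y z)).
  assert (Hg : forall y, P y -> P (g y) /\ R y (g y)).
  { intros y Hy; apply (epsilon_spec (inhabits x) (fun z => P z /\ R y z)); auto. }
  set (f := fix f n := match n with 0 => x | S n => g (f n) end).
  exists f; split; [reflexivity|].
  assert (Hf : forall n, P (f n)) by (induction n; simpl; [auto|apply Hg; auto]).
  intros n; split; auto; apply Hg; auto.
Qed.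

Section Game.
Variables (M : kripke) (xi : formula).
Hypothesis Hxi : tidy xi.
Let G := G_of xi.
Let form (p : pos M G) : formula := proj1_sig (fst p).

Lemma gmove_fmove (p q : pos M G) :
  gmove M G p q <-> fmove M (form p, snd p) (form q, snd q).
Proof.
  destruct p as [[f Hf] t], q as [[g Hg] u]; unfold gmove, fmove, form; simpl.
  destruct f; simpl; split; auto; try contradiction; intros [H _]; inversion H.
Qed.

Lemma fmove_gmove (p : pos M G) f t : fmove M (form p, snd p) (f, t) ->
  exists q : pos M G, gmove M G p q /\ form q = f /\ snd q = t.
Proof.
  intros H.
  exists (exist _ f (Clos_step _ _ _ (proj2_sig (fst p)) (proj1 H)), t).
  split; [apply gmove_fmove; exact H|auto].
Qed.

Lemma form_tidy (p : pos M G) : tidy (form p).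
Proof. apply (Clos_tidy xi); auto; apply (proj2_sig (fst p)). Qed.

(** By [no_bad_trace] the dominating fixpoint is not of type [pol], so its type, and with it the
    winner, is determined. *)
Lemma parity_win_annotated pol (pi : nat -> pos M G) (a : nat -> afm) :
  (forall n, gmove M G (pi n) (pi (S n))) -> (forall n, erase (a n) = form (pi n)) ->
  (forall n, astep pol (a n) (a (S n))) -> (parity_win M G pi <-> pol = FMu).
Proof.
  intros Hm He Ha.
  assert (Hs : forall n, step (form (pi n)) (form (pi (S n))))
    by (intros n; apply gmove_step, Hm).
  destruct (dominating_fixpoint (fun n => form (pi n)) (form_tidy _) Hs)
    as [N [Hfix [Hlen Hinf]]].
  assert (exists e, fix_type (form (pi N)) = Some e) as [e Hty]
    by (destruct (form (pi N)); simpl in *; try contradiction; eauto).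
  pose proof (parity_win_trace M xi pi N e Hxi Hm Hty Hlen Hinf) as Hw.
  fold G in Hw; rewrite Hw.
  assert (e <> pol).
  { intros ->; apply (no_bad_trace pol a N); auto.
    - rewrite He; apply form_tidy.
    - rewrite He; auto.
    - intros n Hn; rewrite !He; auto.
    - intros K; destruct (Hinf K) as [n [Hn E]]; exists n; rewrite !He; auto. }
  destruct e, pol; split; congruence.
Qed.

Definition annotates pol (a : afm) (p : pos M G) : Prop :=
  erase a = form p /\ holds pol M (ValX M) a (snd p).

Lemma annotates_any_move pol a (p q : pos M G) : annotates pol a p ->
  ~ chooses pol (form p) -> gmove M G p q ->
  exists b, annotates pol b q /\ astep pol a b.
Proof.
  intros [He Ha] Hc Hm; apply gmove_fmove in Hm; rewrite <- He in *.
  assert (Ht : tidy (erase a)) by (rewrite He; apply form_tidy).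
  destruct (holds_any_move pol M _ _ _ _ _ Ht Ha Hc Hm) as [b [H1 [H2 H3]]].
  exists b; split; auto; split; auto.
Qed.

Lemma annotates_some_move pol a (p : pos M G) : annotates pol a p ->
  chooses pol (form p) ->
  exists q, gmove M G p q /\ exists b, annotates pol b q /\ astep pol a b.
Proof.
  intros [He Ha] Hc; rewrite <- He in Hc.
  destruct (holds_some_move pol M _ _ _ Ha Hc) as [b [t [H1 [H2 H3]]]].
  rewrite He in H1; destruct (fmove_gmove _ _ _ H1) as [q [Hq [Hf Ht]]].
  exists q; split; auto; exists b; split; auto; split; congruence.
Qed.

Lemma chooses_owner (p : pos M G) :
  (chooses FMu (form p) -> gowner M G p = Eloise) /\
  (chooses FNu (form p) -> gowner M G p = Abelard) /\
  (gowner M G p = Abelard -> chooses FNu (form p)).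
Proof.
  destruct p as [[f Hf] t]; unfold gowner, form; simpl.
  destruct f; simpl; repeat split; auto; try discriminate; tauto.
Qed.

(** The annotating player is never the one who has to choose and cannot. What remains are atoms,
    decided by their truth value, and modalities of the opponent without successors. *)
Lemma stuck_win_annotated pol a (p : pos M G) : annotates pol a p ->
  (forall q, ~ gmove M G p q) -> (stuck_win M G p <-> pol = FMu).
Proof.
  intros Ha Hs.
  assert (Hc : ~ chooses pol (form p)).
  { intros Hc; destruct (annotates_some_move _ _ _ Ha Hc) as [q [Hq _]].
    apply (Hs q Hq). }
  assert (Hf : forall f t, ~ fmove M (form p, snd p) (f, t)).
  { intros f t H; destruct (fmove_gmove _ _ _ H) as [q [Hq _]]; apply (Hs q Hq). }
  destruct Ha as [He Ha]; clear Hs; destruct p as [[f Hp] t].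
  unfold form, stuck_win, holds, fmove in *; simpl in *; subst f.
  destruct a as [| |x|x|x|a b|a b|a|a|e o x c]; simpl in *.
  1-5: destruct pol; simpl; split; try tauto; try congruence.
  - exfalso; apply (Hf (erase a) t); auto using step.
  - exfalso; apply (Hf (erase a) t); auto using step.
  - destruct pol; [tauto|]; split; discriminate.
  - destruct pol; [tauto|]; tauto.
  - exfalso; eapply Hf; split; [constructor|reflexivity].
Qed.

(* Eloise remembers an annotated formula, computed from the history. *)
Lemma sem_pf_sat s : sem M (ValX M) xi s -> pf_sat M G s.
Proof.
  intros Hsem.
  set (p0 := (pvI G, s) : pos M G).
  set (next := fun a q => epsilon (inhabits a) (fun b => annotates FMu b q /\ astep FMu a b)).
  (* Histories list the current position first: [ann] recurses down to the initial position,
     annotated by [embed xi], and extends the annotation move by move. *)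
  set (ann := fix ann (h : list (pos M G)) : afm :=
    match h with
    | [] => embed xi
    | q :: h' => match h' with [] => embed xi | _ :: _ => next (ann h') q end
    end).
  (* The default [p0] concerns only the empty history, which does not arise in a match. *)
  set (good := fun h q => gmove M G (hd p0 h) q /\
    exists b, annotates FMu b q /\ astep FMu (ann h) b).
  set (sg := (fun h => epsilon (inhabits p0) (good h)) : strategy M G).
  assert (Hgood : forall p h, annotates FMu (ann (p :: h)) p ->
    (exists q, gmove M G p q) -> exists q, good (p :: h) q).
  { intros p h Ha [q Hq].
    destruct (excluded_middle_informative (chooses FMu (form p))) as [Hc|Hc].
    - destruct (annotates_some_move _ _ _ Ha Hc) as [q' Hq']; exists q'; exact Hq'.
    - exists q; split; auto; eapply annotates_any_move; eauto. }
  assert (Hnext : forall p q h, annotates FMu (ann (p :: h)) p -> gmove M G p q ->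
    (gowner M G p = Eloise -> q = sg (p :: h)) ->
    annotates FMu (ann (q :: p :: h)) q /\ astep FMu (ann (p :: h)) (ann (q :: p :: h))).
  { intros p q h Ha Hm Ho.
    change (ann (q :: p :: h)) with (next (ann (p :: h)) q).
    apply (epsilon_spec (inhabits (ann (p :: h)))
      (fun b => annotates FMu b q /\ astep FMu (ann (p :: h)) b)).
    (* Fixpoint positions also belong to Eloise, but fall under the second case, together with those
       of Abelard: every move keeps an annotation. *)
    destruct (excluded_middle_informative (chooses FMu (form p))) as [Hc|Hc].
    - rewrite Ho by (apply chooses_owner; auto).
      apply (epsilon_spec (inhabits p0) (good (p :: h))); eauto.
    - eapply annotates_any_move; eauto. }
  assert (H0 : annotates FMu (embed xi) p0).
  { split; [apply erase_embed|]; apply asem_embed; auto. }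
  assert (Hinv : forall h, cons_hist M G sg p0 h ->
    exists p h', h = p :: h' /\ annotates FMu (ann h) p).
  { intros h Hh; induction Hh as [|h p q Hh IH Hm Ho].
    - exists p0, []; auto.
    - destruct IH as [p' [h' [E Ha]]]; injection E as <- <-.
      exists q, (p :: h); split; auto; apply Hnext; auto. }
  exists sg; split; [|split].
  - intros h p Hh _ Hq; destruct (Hinv _ Hh) as [p' [h' [E Ha]]].
    injection E as <- <-.
    apply (epsilon_spec (inhabits p0) (good (p :: h))); auto.
  - intros h p Hh Hq; destruct (Hinv _ Hh) as [p' [h' [E Ha]]].
    injection E as <- <-; eapply stuck_win_annotated; eauto.
  - intros pi Hpi Hm.
    assert (Hh : forall n, exists h, hist M G pi n = pi n :: h /\
      annotates FMu (ann (hist M G pi n)) (pi n)).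
    { induction n as [|n [h [E IH]]]; simpl.
      - exists []; split; auto; rewrite Hpi; auto.
      - exists (hist M G pi n); split; auto.
        destruct (Hm n) as [H1 H2]; rewrite E in *; apply Hnext; auto. }
    apply (parity_win_annotated FMu pi (fun n => ann (hist M G pi n))); auto.
    + intros n; apply Hm.
    + intros n; destruct (Hh n) as [h [_ Ha]]; apply Ha.
    + intros n; destruct (Hh n) as [h [E Ha]]; destruct (Hm n) as [H1 H2].
      simpl hist; rewrite E in *; apply Hnext; auto.
Qed.

(** If [xi] failed at [s], Abelard could answer the given strategy so as to keep an annotation
    forever. The match is built by dependent choice on positions with their history and annotation,
    and is lost for Eloise. *)
Lemma pf_sat_sem s : pf_sat M G s -> sem M (ValX M) xi s.
Proof.
  intros [sg [Hlegal [Hstuck Hinf]]].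
  destruct (excluded_middle_informative (sem M (ValX M) xi s)) as [|Hsem]; auto; exfalso.
  set (p0 := (pvI G, s) : pos M G) in *.
  set (P := fun x : pos M G * list (pos M G) * afm => let '(p, h, a) := x in
    cons_hist M G sg p0 (p :: h) /\ annotates FNu a p).
  set (R := fun x y : pos M G * list (pos M G) * afm =>
    let '(p, h, a) := x in let '(q, h', b) := y in
    h' = p :: h /\ gmove M G p q /\ (gowner M G p = Eloise -> q = sg (p :: h)) /\
    astep FNu a b).
  destruct (dependent_choice P R (p0, [], embed xi)) as [f [Hf0 Hf]].
  - split; [constructor|split; [apply erase_embed|]].
    intros H; apply asem_embed in H; auto.
  - intros [[p h] a] [Hh Ha].
    enough (Hq : exists q, gmove M G p q /\ (gowner M G p = Eloise -> q = sg (p :: h)) /\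
      exists b, annotates FNu b q /\ astep FNu a b).
    { destruct Hq as [q [Hq [Ho [b [Hb Hab]]]]]; exists (q, p :: h, b).
      repeat split; auto; try apply Hb; constructor; auto. }
    destruct (chooses_owner p) as [_ [Ho1 Ho2]].
    destruct (excluded_middle_informative (chooses FNu (form p))) as [Hc|Hc].
    + destruct (annotates_some_move _ _ _ Ha Hc) as [q [Hq Hb]].
      exists q; split; [auto|split; auto].
      rewrite (Ho1 Hc); discriminate.
    (* Eloise moves by [sg] here. If she were stuck, the position would be won by her, which the
       annotation for Abelard refutes. *)
    + assert (Ho : gowner M G p = Eloise).
      { destruct (gowner M G p); auto; tauto. }
      assert (Hm : exists q, gmove M G p q).
      { destruct (excluded_middle_informative (exists q, gmove M G p q)) as [|Hn]; auto.
        assert (Hn' : forall q, ~ gmove M G p q) by eauto.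
        pose proof (Hstuck h p Hh Hn') as Hw.
        apply (stuck_win_annotated FNu a p Ha Hn') in Hw; discriminate. }
      pose proof (Hlegal h p Hh Ho Hm) as Hq.
      exists (sg (p :: h)); split; [auto|split; auto].
      eapply annotates_any_move; eauto.
  - set (pi := fun n => fst (fst (f n))).
    assert (Hall : forall n, cons_hist M G sg p0 (hist M G pi n) /\
      hist M G pi n = pi n :: snd (fst (f n)) /\ annotates FNu (snd (f n)) (pi n) /\
      gmove M G (pi n) (pi (S n)) /\
      (gowner M G (pi n) = Eloise -> pi (S n) = sg (hist M G pi n)) /\
      astep FNu (snd (f n)) (snd (f (S n)))).
    { assert (Hhist : forall n, hist M G pi n = pi n :: snd (fst (f n))).
      { induction n as [|n IH]; simpl.
        - unfold pi; rewrite Hf0; auto.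
        - rewrite IH; f_equal; destruct (Hf n) as [_ H]; unfold R, pi in *.
          destruct (f n) as [[p h] a], (f (S n)) as [[q h'] b]; simpl.
          symmetry; apply H. }
      intros n; rewrite Hhist; destruct (Hf n) as [H1 H2]; unfold P, R, pi in *.
      destruct (f n) as [[p h] a], (f (S n)) as [[q h'] b]; simpl in *; tauto. }
    assert (Hw : parity_win M G pi).
    { apply Hinf.
      - unfold pi; rewrite Hf0; auto.
      - intros n; destruct (Hall n) as [_ [_ [_ [H1 [H2 _]]]]]; auto. }
    apply (parity_win_annotated FNu pi (fun n => snd (f n))) in Hw; [discriminate| | |];
      intros n; destruct (Hall n) as [_ [_ [[H0 _] [H1 [_ H2]]]]]; auto.
Qed.
End Game.

Theorem mainTheorem1 (xi : formula) :
  tidy xi ->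
  (* G_xi is a parity formula *)
  is_parity_formula (G_of xi) /\
  (* G_xi is equivalent to xi *)
  (forall (M : kripke) (s : St M), pf_sat M (G_of xi) s <-> fsat M s xi) /\
  (* G_xi has exactly |Clos(xi)| vertices *)
  (exists (l : list formula) (lv : list (pV (G_of xi))),
      NoDup l /\ (forall psi, In psi l <-> Clos xi psi) /\
      NoDup lv /\ (forall v, In v lv) /\ length lv = length l) /\
  (* ind(G_xi) <= ad(xi) *)
  (exists i a, ind (G_of xi) = Some i /\ ad xi = Some a /\ i <= a).
Proof.
  intros Ht; split; [|split; [|split]].
  - apply G_of_parity_formula; auto.
  - intros M s; split; [apply pf_sat_sem; auto|apply sem_pf_sat; auto].
  - apply vertices_enum; auto.
  - apply ind_le_ad; auto.
Qed.
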